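(* Let $1<q<p$ and fix $s_1\in(0,1)$. Put $s_2'=H_q(\omega_p(s_1))$ and $s_2''=\max\big(s_1^{\frac{q-1}{p-1}},\,h^{-1}(1/s_1^q)\big)$. Then the function $s_2\mapsto t(s_1,s_2)$ satisfies $$\frac{\partial t}{\partial s_2}(s_1,s_2)>0\quad\text{for all } s_2\in[s_2'',s_2'),\qquad \frac{\partial t}{\partial s_2}(s_1,s_2)<0\quad\text{for all } s_2\in(s_2',1).$$
   Context: Let $1<q<p$. For $r>1$ let $H_r(z)=-(r-1)z^r+rz^{r-1}$, which is strictly decreasing from $[1,\frac{r}{r-1}]$ onto $[0,1]$, and let $\omega_r:[0,1]\to[1,\frac{r}{r-1}]$ be its inverse. For $s_2\in(0,1)$ set $\alpha(s_2)=\frac{\omega_q(s_2)^q}{s_2}-1$ and $$h(s_2)=\frac{\left(\frac1{s_2}+\frac{p-q}{q}\alpha(s_2)\right)^p}{\left(1+\frac pq\alpha(s_2)\right)^{p-q}};$$ $h$ is a strictly decreasing bijection from $(0,1)$ onto $(1,\infty)$, with inverse $h^{-1}$. Let $D=\{(s_1,s_2)\in\mathbb{R}^2: 0<s_1^{q-1}\le s_2^{p-1}<1\}$. For $(s_1,s_2)\in D$ let $t_0=t_0(s_1,s_2)$ be the unique number in $[1,\infty)$ with $$t_0^p-\frac{p}{p-q}t_0^{p-q}=s_1-\frac{p}{p-q}\frac{s_1}{s_2}.$$ For $t\ge 1$ set $\tau(s_1,s_2,t)=\frac{p-q}{p}\,\frac{t^p-s_1}{t^{p-q}-\frac{s_1}{s_2}}$,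 which is strictly increasing in $t$ on $[1,\infty)$ and equals $1$ at $t=t_0$. The function $t(s_1,s_2)$ on $D$ is defined as follows. (a) If $h^{-1}(1/s_1^q)\le s_2<1$, then $t(s_1,s_2)$ is the unique solution $t\in[1,t_0]$ of $$q\big(p\,\omega_q(\tau)^{q-1}-(p-1)\,\omega_q(\tau)^q\big)\Big(t^{p-q}-\frac{s_1}{s_2}\Big)=(p-q)\,s_1\,\alpha(s_2),\qquad \tau=\tau(s_1,s_2,t).$$ (b) If $s_2<h^{-1}(1/s_1^q)$, then $t(s_1,s_2)=t_0(s_1,s_2)$. The function $t$ is continuous on $D$. If $s_2=s_1^{\frac{q-1}{p-1}}$ (the left endpoint of the admissible range of $s_2$ for fixed $s_1$), the derivative with respect to $s_2$ is understood as a right derivative. *)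

(* Defs.v *)
From Stdlib Require Import Reals.
From Coquelicot Require Import Coquelicot.
Open Scope R_scope.

(* All real powers are [Rpower x y = exp (y * ln x)], which is the usual power
   only for [0 < x]; every base below is positive on the relevant domain.
   Inverses and implicitly defined numbers are definite descriptions:
   [iota P] is the unique real satisfying [P] (see [iota_correct]), and is
   meaningful only where existence and uniqueness hold. *)

Definition H (r z : R) : R :=
  - (r - 1) * Rpower z r + r * Rpower z (r - 1).

Definition omega (r y : R) : R :=
  iota (fun z : R => 1 <= z <= r / (r - 1) /\ H r z = y).

Definition alpha (q s2 : R) : R := Rpower (omega q s2) q / s2 - 1.

Definition h (p q s2 : R) : R :=
  Rpower (1 / s2 + (p - q) / q * alpha q s2) p
  / Rpower (1 + p / q * alpha q s2) (p - q).

Definition h_inv (p q y : R) : R :=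
  iota (fun x : R => 0 < x < 1 /\ h p q x = y).

(* Positivity of [s1] and [s2] is explicit because [Rpower] is positive even at
   nonpositive bases. *)
Definition D (p q s1 s2 : R) : Prop :=
  0 < s1 /\ 0 < s2 /\
  Rpower s1 (q - 1) <= Rpower s2 (p - 1) < 1.

Definition t0 (p q s1 s2 : R) : R :=
  iota (fun t : R => 1 <= t /\
    Rpower t p - p / (p - q) * Rpower t (p - q)
    = s1 - p / (p - q) * (s1 / s2)).

Definition tau (p q s1 s2 t : R) : R :=
  (p - q) / p * ((Rpower t p - s1) / (Rpower t (p - q) - s1 / s2)).

Definition t_equation (p q s1 s2 t : R) : Prop :=
  let w := omega q (tau p q s1 s2 t) in
  q * (p * Rpower w (q - 1) - (p - 1) * Rpower w q)
    * (Rpower t (p - q) - s1 / s2)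
  = (p - q) * s1 * alpha q s2.

Definition t (p q s1 s2 : R) : R :=
  if Rle_dec (h_inv p q (1 / Rpower s1 q)) s2
  then iota (fun x : R => 1 <= x <= t0 p q s1 s2 /\ t_equation p q s1 s2 x)
  else t0 p q s1 s2.

(* [l] is the partial derivative of [t] in [s2] at [(s1, s2)], relative to the
   slice [{x | D p q s1 x}].  For [0 < s1 < 1] this slice is
   [[s1^((q-1)/(p-1)), 1)], so the derivative is two-sided except at the left
   endpoint, where it is the right derivative. *)
Definition is_dt_ds2 (p q s1 s2 l : R) : Prop :=
  D_in (fun x => t p q s1 x) (fun _ => l) (fun x => D p q s1 x) s2.

Definition s2_prime (p q s1 : R) : R := H q (omega p s1).

Definition s2_second (p q s1 : R) : R :=
  Rmax (Rpower s1 ((q - 1) / (p - 1))) (h_inv p q (1 / Rpower s1 q)).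

(* Main.v *)
Require Import Defs.
From Stdlib Require Import Reals Lra.
From Coquelicot Require Import Coquelicot.
Open Scope R_scope.

(** Write [a = omega q s2], [w = omega q tau], [c = s1 / s2] and
    [E = t^(p-q) - c].  Since [H q a = s2], one has
    [s1 * (1 + alpha q s2) = c * a^q], and the definition of [tau], together
    with its difference from the equation defining [t], becomes the system
<<
      (1)   p * H_q(w) * E   = (p - q) * (t^p - s1)
      (2)   w^q * E + c * a^q = t^p
>>
    ([width_gap], [width_pow_gap]).  It is smooth in [t], [w] and [s2] even at
    [w = 1], where [omega q] has infinite slope.  Writing the increments of both
    relations as slopes times increments of [t], [w], [s2] and eliminating the
    increment of [w] gives
<<
      dt/ds2 = (s1 / s2^2) * (w^q - (w - 1) * a^q / (a - 1))
               / (t^(p-q-1) * (t^q * (q(p-1)w - p(q-1)) - (p-q) * w^q))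
>>
    ([t_deriv_after]).  On the branch [t = t0] only (1) holds, with [w = 1]; as
    (1) is stationary in [w] at [w = 1], it yields the same number at the point
    where the branches meet ([t_deriv_before]), so the derivative there is
    two-sided.

    The denominator is positive because [t > 1] and [1 <= w < p / (p - 1)]
    ([t_den_pos]).  As [z^q / (z - 1)] decreases on [(1, q / (q - 1)]], the
    numerator has the sign of [a - w].  By (2), [t^q] is a weighted mean of
    [w^q] and [a^q], so [w >= a] forces [t >= a] and then [tau(t) >= tau(a)];
    but [tau(a)] and [H_q(a) = s2] compare as [s1] and [H_p(a)] do, that is, as
    [a] and [b = omega p s1] do.  Hence [w < a] exactly when [a > b], i.e. when
    [s2 < H_q(b)], the turning point ([width_vs_omega]).

    That [t] is well defined and continuous comes from two monotonicities in
    the variable [t]: [tau] increases ([tau_incr]), and the left side of the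
    equation increases wherever it is positive ([lhs_incr]).  Thus [t] is the
    point where [max (tau - 1, lhs - rhs)] changes sign, in both branches at
    once ([before_t], [after_t]), and this sign is continuous in [s2].  The
    branches are told apart through [level_root]: [h p q s = 1 / s1^q] yields a
    point [T > 1] with [tau = 1] and [T^p = s1 * (1 + p/q * alpha q s)], whose
    left side grows with [s] while the right side decreases. *)

(** * Real powers *)

Lemma Rpower_pos (x y : R) : 0 < Rpower x y.
Proof. apply exp_pos. Qed.

Lemma Rpower_pred (x y : R) : 0 < x -> Rpower x y = x * Rpower x (y - 1).
Proof.
  intros hx. rewrite <- (Rpower_1 x hx) at 2. rewrite <- Rpower_plus.
  f_equal; ring.
Qed.

Lemma Rpower_one_l (y : R) : Rpower 1 y = 1.
Proof. unfold Rpower. rewrite ln_1, Rmult_0_r. apply exp_0. Qed.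

Lemma Rpower_ge_1 (x y : R) : 1 <= x -> 0 <= y -> 1 <= Rpower x y.
Proof.
  intros hx hy. rewrite <- (Rpower_one_l y). apply Rle_Rpower_l; lra.
Qed.

Lemma Rpower_gt_1 (x y : R) : 1 < x -> 0 < y -> 1 < Rpower x y.
Proof.
  intros hx hy. assert (hc := Rlt_Rpower_l 1 x y hy). rewrite Rpower_one_l in hc. lra.
Qed.

Lemma Rpower_lt_1 (x y : R) : 0 < x < 1 -> 0 < y -> Rpower x y < 1.
Proof.
  intros hx hy. assert (hc := Rlt_Rpower_l x 1 y hy). rewrite Rpower_one_l in hc. lra.
Qed.

Lemma Rpower_lt_iff (x y e : R) : 0 < e -> 0 < x -> 0 < y ->
  (Rpower x e < Rpower y e <-> x < y).
Proof.
  intros he hx hy; split; intros hlt.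
  - destruct (Rlt_or_le x y) as [?|hle]; [assumption|].
    assert (hc := Rle_Rpower_l y x e). lra.
  - apply Rlt_Rpower_l; lra.
Qed.

Lemma Rpower_inj (x y e : R) : 0 < e -> 0 < x -> 0 < y ->
  Rpower x e = Rpower y e -> x = y.
Proof.
  intros he hx hy heq.
  destruct (Rtotal_order x y) as [hl|[hl|hl]]; [|assumption|].
  - assert (hc := Rlt_Rpower_l x y e). lra.
  - assert (hc := Rlt_Rpower_l y x e). lra.
Qed.

Lemma ln_le_sub1 (x : R) : 0 < x -> ln x <= x - 1.
Proof.
  intros hx. assert (hc := exp_ineq1_le (ln x)). rewrite exp_ln in hc; lra.
Qed.

(** Weighted arithmetic-geometric mean of [1] and [x]: apply [ln z <= z - 1] to
    [1 / X] and [x / X], where [X] is the right-hand side. *)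
Lemma Rpower_bernoulli (x e : R) : 0 < x -> 0 < e < 1 ->
  Rpower x e <= 1 + e * (x - 1).
Proof.
  intros hx he. set (X := 1 + e * (x - 1)).
  assert (hX : 0 < X) by (unfold X; nra).
  assert (h1 := ln_le_sub1 (/ X) (Rinv_0_lt_compat _ hX)).
  assert (h2 := ln_le_sub1 (x * / X) (Rmult_lt_0_compat _ _ hx (Rinv_0_lt_compat _ hX))).
  rewrite ln_mult in h2 by (auto; apply Rinv_0_lt_compat; auto).
  rewrite ln_Rinv in h1, h2 by auto.
  assert (h3 : (1 - e) * (/ X - 1) + e * (x * / X - 1) = 0)
    by (unfold X in *; field; lra).
  unfold Rpower. rewrite <- (exp_ln X hX).
  assert (hl : e * ln x <= ln X).
  { assert ((1 - e) * (- ln X) <= (1 - e) * (/ X - 1)) by (apply Rmult_le_compat_l; lra).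
    assert (e * (ln x + - ln X) <= e * (x * / X - 1)) by (apply Rmult_le_compat_l; lra).
    nra. }
  destruct hl as [hl|hl]; [left; apply exp_increasing; auto | right; now rewrite hl].
Qed.

Lemma increasing_of_deriv (f f' : R -> R) (x y : R) : x < y ->
  (forall c, x <= c <= y -> derivable_pt_lim f c (f' c)) ->
  (forall c, x < c < y -> 0 < f' c) -> f x < f y.
Proof.
  intros hxy hd hp. destruct (MVT_cor2 f f' x y hxy hd) as [c [hc1 hc2]].
  assert (h1 := hp c hc2). nra.
Qed.

Lemma deriv_eq (f : R -> R) (x l l' : R) : l = l' ->
  derivable_pt_lim f x l -> derivable_pt_lim f x l'.
Proof. now intros ->. Qed.

(** * Limits along a set, and slopes *)

Lemma lim_cont (f y : R -> R) (S : R -> Prop) (y0 x0 : R) :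
  continuity_pt f y0 -> limit1_in y S y0 x0 ->
  limit1_in (fun s => f (y s)) S (f y0) x0.
Proof.
  intros hf hy eps he.
  destruct (hf eps he) as [d [hd1 hd2]]. destruct (hy d hd1) as [d' [hd1' hd2']].
  exists d'. split; [assumption|]. intros x hx.
  destruct (Req_dec (y x) y0) as [->|hne].
  - unfold R_met, dist; simpl. rewrite Rdist_eq; lra.
  - apply hd2. split; [split; [exact I|auto]|]. now apply hd2'.
Qed.

Lemma lim_const (c : R) (S : R -> Prop) (x0 : R) : limit1_in (fun _ => c) S c x0.
Proof.
  intros eps he. exists 1. split; [lra|]. intros x _.
  unfold R_met, dist; simpl. rewrite Rdist_eq; lra.
Qed.

Lemma lim_eq (f : R -> R) (S : R -> Prop) (l l' x0 : R) :
  l = l' -> limit1_in f S l x0 -> limit1_in f S l' x0.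
Proof. now intros ->. Qed.

Lemma lim_pt (f : R -> R) (x0 : R) :
  limit1_in f (D_x no_cond x0) (f x0) x0 -> continuity_pt f x0.
Proof. intros hl. exact hl. Qed.

Lemma lim_div (f g : R -> R) (S : R -> Prop) (l m x0 : R) :
  limit1_in f S l x0 -> limit1_in g S m x0 -> m <> 0 ->
  limit1_in (fun s => f s / g s) S (l / m) x0.
Proof. intros hf hg hm. apply limit_mul; [auto|]. now apply limit_inv. Qed.

Lemma lim_ext_near (f g : R -> R) (S : R -> Prop) (l x0 d : R) : 0 < d ->
  (forall x, S x -> Rabs (x - x0) < d -> f x = g x) ->
  limit1_in f S l x0 -> limit1_in g S l x0.
Proof.
  intros hd hfg hf eps he. destruct (hf eps he) as [d' [hd1 hd2]].
  exists (Rmin d d'). split; [apply Rmin_Rgt_r; lra|].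
  intros x [hx1 hx2]. unfold R_met, dist, Rdist in *; simpl in *.
  rewrite <- hfg; [apply hd2; split; auto|auto|].
  - eapply Rlt_le_trans; [apply hx2|apply Rmin_r].
  - eapply Rlt_le_trans; [apply hx2|apply Rmin_l].
Qed.

Lemma lim_union (f : R -> R) (A B S : R -> Prop) (l x0 : R) :
  (forall x, S x -> A x \/ B x) ->
  limit1_in f A l x0 -> limit1_in f B l x0 -> limit1_in f S l x0.
Proof.
  intros hS hA hB eps he.
  destruct (hA eps he) as [d [hd1 hd2]]. destruct (hB eps he) as [d' [hd1' hd2']].
  exists (Rmin d d'). split; [apply Rmin_Rgt_r; lra|].
  intros x [hx1 hx2].
  assert (h1 := Rmin_l d d'). assert (h2 := Rmin_r d d').
  destruct (hS x hx1); [apply hd2|apply hd2']; split; auto; lra.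
Qed.

Lemma lim_lt_near (f : R -> R) (S : R -> Prop) (l x0 c : R) :
  limit1_in f S l x0 -> l < c ->
  exists d, 0 < d /\ forall x, S x -> Rabs (x - x0) < d -> f x < c.
Proof.
  intros hf hl. destruct (hf (c - l)) as [d [hd1 hd2]]; [lra|].
  exists d; split; [auto|]. intros x hx1 hx2.
  assert (hc := hd2 x (conj hx1 hx2)).
  unfold R_met, dist, Rdist in hc; simpl in hc.
  apply Rabs_def2 in hc. lra.
Qed.

Lemma lim_gt_near (f : R -> R) (S : R -> Prop) (l x0 c : R) :
  limit1_in f S l x0 -> c < l ->
  exists d, 0 < d /\ forall x, S x -> Rabs (x - x0) < d -> c < f x.
Proof.
  intros hf hl.
  destruct (lim_lt_near (fun x => - f x) S (- l) x0 (- c)) as [d [h1 h2]].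
  - now apply limit_Ropp.
  - lra.
  - exists d; split; auto. intros x hx1 hx2. assert (hc := h2 x hx1 hx2). lra.
Qed.

(** The increment of a differentiable [f] along any convergent [y] factors
    through the increment of [y], with a convergent slope.  With [lim_ratio]
    this is implicit differentiation for functions known only to be continuous
    and to satisfy relations on an arbitrary set of parameters. *)
Lemma lim_slope (f y : R -> R) (l : R) (S : R -> Prop) (y0 x0 : R) :
  derivable_pt_lim f y0 l -> limit1_in y S y0 x0 ->
  exists m : R -> R,
    (forall s, f (y s) - f y0 = m s * (y s - y0)) /\ limit1_in m S l x0.
Proof.
  intros hf hy.
  set (m := fun z => if Req_dec_T z y0 then l else (f z - f y0) / (z - y0)).
  assert (hm0 : m y0 = l).
  { unfold m. destruct (Req_dec_T y0 y0); [auto|contradiction]. }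
  exists (fun s => m (y s)). split.
  - intros s. unfold m. destruct (Req_dec_T (y s) y0) as [hz|hne]; [rewrite hz; ring|field; lra].
  - rewrite <- hm0. apply lim_cont; [|assumption].
    intros eps he. destruct (hf eps he) as [d hd].
    exists d. split; [apply cond_pos|]. intros z [[_ hz1] hz2].
    rewrite hm0. unfold m.
    destruct (Req_dec_T z y0) as [hz|hz]; [unfold R_met, dist; simpl; rewrite Rdist_eq; lra|].
    unfold R_met, dist, Rdist in *; simpl in *.
    assert (hc := hd (z - y0)). replace (y0 + (z - y0)) with z in hc by ring.
    apply hc; lra.
Qed.

Lemma lim_ratio (A B u v : R -> R) (S : R -> Prop) (a b x0 : R) :
  (forall s, S s -> A s * u s + B s * v s = 0) ->
  (forall s, S s -> v s <> 0) ->
  limit1_in A S a x0 -> limit1_in B S b x0 -> a <> 0 ->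
  limit1_in (fun s => u s / v s) S (- b / a) x0.
Proof.
  intros heq hv hA hB ha.
  assert (hnz : exists d, 0 < d /\ forall x, S x -> Rabs (x - x0) < d -> A x <> 0).
  { destruct (Rtotal_order a 0) as [hl|[hl|hl]]; [|lra|].
    - destruct (lim_lt_near _ _ _ _ _ hA hl) as [d [h1 h2]].
      exists d; split; auto. intros x hx1 hx2. assert (hc := h2 x hx1 hx2); lra.
    - destruct (lim_gt_near _ _ _ _ _ hA hl) as [d [h1 h2]].
      exists d; split; auto. intros x hx1 hx2. assert (hc := h2 x hx1 hx2); lra. }
  destruct hnz as [d [hd1 hd2]].
  apply lim_ext_near with (f := fun s => - B s / A s) (d := d); auto.
  - intros x hx1 hx2. assert (h1 := hd2 x hx1 hx2). assert (h2 := hv x hx1).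
    assert (h3 := heq x hx1). apply (Rmult_eq_reg_r (A x * v x)).
    + field_simplify; auto. lra.
    + now apply Rmult_integral_contrapositive.
  - apply lim_div; auto. now apply limit_Ropp.
Qed.

Lemma derivable_of_lim (f : R -> R) (x l : R) :
  limit1_in (fun y => (f y - f x) / (y - x)) (fun y => y <> x) l x ->
  derivable_pt_lim f x l.
Proof.
  intros hl eps he. destruct (hl eps he) as [d [hd1 hd2]].
  exists (mkposreal d hd1). intros z hz1 hz2. simpl in hz2.
  assert (hc := hd2 (x + z)). unfold R_met, dist, Rdist in hc; simpl in hc.
  replace (x + z - x) with z in hc by ring. apply hc. split; [lra|auto].
Qed.

Lemma iota_eq (P : R -> Prop) (x : R) :
  P x -> (forall y, P y -> y = x) -> iota P = x.
Proof.
  intros hx hu. exact (@iota_unique R_AbsRing R_CompleteNormedModule P x hu hx).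
Qed.

(** * The function H and its inverse omega *)

Lemma H_factor (r z : R) : 0 < z -> H r z = Rpower z (r - 1) * (r - (r - 1) * z).
Proof. intros hz. unfold H. rewrite (Rpower_pred z r hz). ring. Qed.

Lemma H_deriv (r z : R) : 0 < z ->
  derivable_pt_lim (H r) z (r * (r - 1) * (Rpower z (r - 2) * (1 - z))).
Proof.
  intros hz. unfold H.
  eapply deriv_eq.
  2:{ apply (derivable_pt_lim_plus (fun z => - (r - 1) * Rpower z r) (fun z => r * Rpower z (r - 1))).
      - apply (derivable_pt_lim_scal (fun z => Rpower z r)). apply derivable_pt_lim_power; auto.
      - apply (derivable_pt_lim_scal (fun z => Rpower z (r - 1))). apply derivable_pt_lim_power; auto. }
  rewrite (Rpower_pred z (r - 1) hz). replace (r - 1 - 1) with (r - 2) by ring. ring.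
Qed.

Lemma H_cont (r z : R) : 0 < z -> continuity_pt (H r) z.
Proof.
  intros hz. apply derivable_continuous_pt. eexists. now apply H_deriv.
Qed.

Lemma H_decr (r x y : R) : 1 < r -> 1 <= x -> x < y -> H r y < H r x.
Proof.
  intros hr hx hxy.
  cut (- H r x < - H r y); [lra|].
  apply (increasing_of_deriv (fun z => - H r z)
    (fun z => - (r * (r - 1) * (Rpower z (r - 2) * (1 - z))))); auto.
  - intros c hc. apply (derivable_pt_lim_opp (H r)). apply H_deriv; lra.
  - intros c hc. assert (h1 := Rpower_pos c (r - 2)).
    assert (0 < r * (r - 1)) by nra. assert (0 < Rpower c (r - 2) * (c - 1)) by nra. nra.
Qed.

Lemma H_at_1 (r : R) : H r 1 = 1.
Proof. unfold H. rewrite !Rpower_one_l. ring. Qed.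

Lemma conj_gt_1 (r : R) : 1 < r -> 1 < r / (r - 1).
Proof. intros hr. apply Rlt_div_r; lra. Qed.

Lemma H_at_conj (r : R) : 1 < r -> H r (r / (r - 1)) = 0.
Proof.
  intros hr. assert (hc := conj_gt_1 r hr). rewrite H_factor by lra.
  replace (r - (r - 1) * (r / (r - 1))) with 0 by (field; lra). ring.
Qed.

Lemma H_inj (r x y : R) : 1 < r -> 1 <= x -> 1 <= y -> H r x = H r y -> x = y.
Proof.
  intros hr hx hy he. destruct (Rtotal_order x y) as [hl|[hl|hl]]; auto.
  - assert (hc := H_decr r x y). lra.
  - assert (hc := H_decr r y x). lra.
Qed.

Lemma omega_H (r z : R) : 1 < r -> 1 <= z <= r / (r - 1) -> omega r (H r z) = z.
Proof.
  intros hr hz. apply iota_eq; [split; [exact hz|reflexivity]|].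
  intros y [hy1 hy2]. apply (H_inj r); lra.
Qed.

Lemma omega_spec (r y : R) : 1 < r -> 0 <= y <= 1 ->
  1 <= omega r y <= r / (r - 1) /\ H r (omega r y) = y.
Proof.
  intros hr hy. assert (hc := conj_gt_1 r hr).
  assert (hex : exists z, 1 <= z <= r / (r - 1) /\ H r z = y).
  { destruct (Req_dec y 1) as [->|h1].
    { exists 1. split; [lra|apply H_at_1]. }
    destruct (Req_dec y 0) as [->|h0].
    { exists (r / (r - 1)). split; [lra|now apply H_at_conj]. }
    destruct (Ranalysis5.IVT_interv (fun z => y - H r z) 1 (r / (r - 1)))
      as [z [hz1 hz2]]; auto.
    - intros z hz. apply (continuity_pt_minus (fun _ => y) (H r)).
      + apply continuity_pt_const. now intros ? ?.
      + apply H_cont; lra.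
    - rewrite H_at_1; lra.
    - rewrite H_at_conj; lra.
    - exists z. split; [auto|lra]. }
  destruct hex as [z [hz1 <-]]. rewrite omega_H; auto.
Qed.

Lemma omega_decr (r x y : R) : 1 < r -> 0 <= x -> y <= 1 -> x < y ->
  omega r y < omega r x.
Proof.
  intros hr hx hy hxy.
  destruct (omega_spec r x hr) as [hx1 hx2]; [lra|].
  destruct (omega_spec r y hr) as [hy1 hy2]; [lra|].
  destruct (Rlt_or_le (omega r y) (omega r x)) as [|hle]; auto.
  destruct hle as [hl|hl].
  - assert (hc := H_decr r (omega r x) (omega r y)). lra.
  - rewrite hl in hx2. lra.
Qed.

Lemma omega_at_1 (r : R) : 1 < r -> omega r 1 = 1.
Proof.
  intros hr. rewrite <- (H_at_1 r) at 1. apply omega_H; auto.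
  assert (hc := conj_gt_1 r hr); lra.
Qed.

Lemma omega_interior (r y : R) : 1 < r -> 0 < y < 1 ->
  1 < omega r y < r / (r - 1).
Proof.
  intros hr hy. destruct (omega_spec r y hr) as [h1 h2]; [lra|]. split.
  - rewrite <- (omega_at_1 r hr). apply omega_decr; lra.
  - destruct (proj2 h1) as [|he]; auto. rewrite he, H_at_conj in h2; lra.
Qed.

Lemma omega_modulus (r y0 eps : R) : 1 < r -> 0 <= y0 <= 1 -> 0 < eps ->
  exists d, 0 < d /\ forall y, 0 <= y <= 1 -> Rabs (y - y0) < d ->
    Rabs (omega r y - omega r y0) < eps.
Proof.
  intros hr hy0 he. destruct (omega_spec r y0 hr hy0) as [hz1 hz2].
  set (z0 := omega r y0) in *.
  assert (hup : exists d, 0 < d /\ forall y, 0 <= y <= 1 -> Rabs (y - y0) < d ->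
    omega r y < z0 + eps).
  { destruct (Rlt_or_le (r / (r - 1)) (z0 + eps)) as [hl|hl].
    - exists 1. split; [lra|]. intros y hy _.
      destruct (omega_spec r y hr hy). lra.
    - exists (y0 - H r (z0 + eps)). assert (hd := H_decr r z0 (z0 + eps)).
      split; [lra|]. intros y hy1 hy2. apply Rabs_def2 in hy2.
      destruct (omega_spec r y hr hy1) as [h1 h2].
      destruct (Rlt_or_le (omega r y) (z0 + eps)) as [|[hc|hc]]; auto.
      + assert (h3 := H_decr r (z0 + eps) (omega r y)). lra.
      + rewrite <- hc in h2. lra. }
  assert (hlo : exists d, 0 < d /\ forall y, 0 <= y <= 1 -> Rabs (y - y0) < d ->
    z0 - eps < omega r y).
  { destruct (Rlt_or_le (z0 - eps) 1) as [hl|hl].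
    - exists 1. split; [lra|]. intros y hy _.
      destruct (omega_spec r y hr hy). lra.
    - exists (H r (z0 - eps) - y0). assert (hd := H_decr r (z0 - eps) z0).
      split; [lra|]. intros y hy1 hy2. apply Rabs_def2 in hy2.
      destruct (omega_spec r y hr hy1) as [h1 h2].
      destruct (Rlt_or_le (z0 - eps) (omega r y)) as [|[hc|hc]]; auto.
      + assert (h3 := H_decr r (omega r y) (z0 - eps)). lra.
      + rewrite hc in h2. lra. }
  destruct hup as [d1 [h1 h2]]. destruct hlo as [d2 [h3 h4]].
  exists (Rmin d1 d2). split; [apply Rmin_Rgt_r; lra|].
  intros y hy1 hy2. assert (h5 := Rmin_l d1 d2). assert (h6 := Rmin_r d1 d2).
  assert (h7 := h2 y hy1). assert (h8 := h4 y hy1). apply Rabs_def1; lra.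
Qed.

Lemma omega_cont (r y : R) : 1 < r -> 0 < y < 1 -> continuity_pt (omega r) y.
Proof.
  intros hr hy eps he. destruct (omega_modulus r y eps hr) as [d [h1 h2]]; [lra|auto|].
  exists (Rmin d (Rmin y (1 - y))).
  assert (h3 : 0 < Rmin y (1 - y)) by (apply Rmin_glb_lt; lra).
  split; [apply Rmin_glb_lt; lra|].
  intros x [_ hx]. unfold R_met, dist, Rdist in *; simpl in *.
  assert (h4 := Rmin_l d (Rmin y (1 - y))). assert (h5 := Rmin_r d (Rmin y (1 - y))).
  assert (h6 := Rmin_l y (1 - y)). assert (h7 := Rmin_r y (1 - y)).
  apply h2; [|lra]. assert (hx' : Rabs (x - y) < Rmin y (1 - y)) by lra.
  apply Rabs_def2 in hx'. lra.
Qed.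

Lemma omega_clamp_cont (r y : R) : 1 < r -> 0 < y ->
  continuity_pt (fun z => omega r (Rmin 1 z)) y.
Proof.
  intros hr hy eps he.
  destruct (omega_modulus r (Rmin 1 y) eps hr) as [d [h1 h2]]; auto.
  { split; [apply Rlt_le, Rmin_glb_lt; lra|apply Rmin_l]. }
  exists (Rmin d y). split; [apply Rmin_glb_lt; lra|].
  intros x [_ hx]. unfold R_met, dist, Rdist in *; simpl in *.
  assert (h4 := Rmin_l d y). assert (h5 := Rmin_r d y).
  assert (hx' : Rabs (x - y) < d) by lra. assert (hx2 : Rabs (x - y) < y) by lra.
  apply Rabs_def2 in hx2. apply h2.
  - split; [apply Rlt_le, Rmin_glb_lt; lra|apply Rmin_l].
  - eapply Rle_lt_trans; [|exact hx'].
    unfold Rmin. destruct (Rle_dec 1 x), (Rle_dec 1 y);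
      unfold Rabs; repeat destruct Rcase_abs; lra.
Qed.

Lemma omega_deriv (r y : R) : 1 < r -> 0 < y < 1 ->
  let z := omega r y in
  derivable_pt_lim (omega r) y (1 / (r * (r - 1) * (Rpower z (r - 2) * (1 - z)))).
Proof.
  intros hr hy z. assert (hz := omega_interior r y hr hy). fold z in hz.
  apply derivable_of_lim.
  destruct (lim_slope (H r) (omega r) _ (fun x => x <> y /\ 0 < x < 1) z y
    (H_deriv r z ltac:(lra))) as [m [hm1 hm2]].
  { intros eps he. destruct (omega_cont r y hr hy eps he) as [d [h1 h2]].
    exists d; split; auto. intros x [hx1 hx2]. apply h2. split; auto.
    split; [exact I|]. intros ->; tauto. }
  assert (hnz : r * (r - 1) * (Rpower z (r - 2) * (1 - z)) <> 0).
  { assert (h1 := Rpower_pos z (r - 2)).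
    repeat apply Rmult_integral_contrapositive_currified; lra. }
  assert (hlim : limit1_in (fun x => (omega r x - omega r y) / (x - y))
     (fun x => x <> y /\ 0 < x < 1) (1 / (r * (r - 1) * (Rpower z (r - 2) * (1 - z)))) y).
  { eapply lim_eq; [|apply (lim_ratio m (fun _ => -1) (fun x => omega r x - omega r y)
      (fun x => x - y) _ _ (-1) _) with (3 := hm2) (5 := hnz); [| |apply lim_const]].
    - field. repeat split; try lra. apply Rgt_not_eq, Rpower_pos.
    - intros s [hs1 hs2]. fold z. assert (hc := hm1 s).
      destruct (omega_spec r s hr) as [_ h1]; [lra|].
      destruct (omega_spec r y hr) as [_ h2]; [lra|].
      fold z in h2. rewrite h1, h2 in hc. lra.
    - intros s [hs1 hs2]. lra. }
  intros eps he. destruct (hlim eps he) as [d [h1 h2]].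
  exists (Rmin d (Rmin y (1 - y))).
  assert (h3 : 0 < Rmin y (1 - y)) by (apply Rmin_glb_lt; lra).
  split; [apply Rmin_glb_lt; lra|].
  intros x [hx0 hx]. unfold R_met, dist, Rdist in *; simpl in *.
  assert (h4 := Rmin_l d (Rmin y (1 - y))). assert (h5 := Rmin_r d (Rmin y (1 - y))).
  assert (h6 := Rmin_l y (1 - y)). assert (h7 := Rmin_r y (1 - y)).
  apply h2. split; [|lra]. split; auto. assert (hx' : Rabs (x - y) < Rmin y (1 - y)) by lra.
  apply Rabs_def2 in hx'. lra.
Qed.

(** * The two sides of the equation for t, at fixed s1 *)

Section Slice.

Variables p q s1 : R.
Hypothesis hpq : 1 < q < p.
Hypothesis hs1 : 0 < s1 < 1.

(** The second inequality says [tau p q s1 s 1 < 1]; it follows from membership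
    in the domain ([D_admissible]), and the theory of [t] rests on it alone. *)
Definition admissible (s : R) : Prop :=
  0 < s < 1 /\ p * (s1 / s) < q + (p - q) * s1.

Definition gap (s x : R) : R := Rpower x (p - q) - s1 / s.

(** Clamping at [1] makes [width] continuous across [x = t0], and equal to [1]
    on the branch [t = t0]. *)
Definition width (s x : R) : R := omega q (Rmin 1 (tau p q s1 s x)).

Definition lhs (s x : R) : R :=
  let w := width s x in
  q * (p * Rpower w (q - 1) - (p - 1) * Rpower w q) * gap s x.

Definition rhs (s : R) : R := (p - q) * s1 * alpha q s.

(** The function of [t] in the equation for [t0]. *)
Definition profile (x : R) : R := Rpower x p - p / (p - q) * Rpower x (p - q).

Lemma alpha_pos (s : R) : 0 < s < 1 -> 0 < alpha q s.
Proof.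
  intros hs. unfold alpha.
  assert (hq : 1 < q) by lra.
  assert (ha := omega_interior q s hq hs).
  assert (h1 := Rpower_ge_1 (omega q s) q ltac:(lra) ltac:(lra)).
  assert (1 < Rpower (omega q s) q / s) by (apply Rlt_div_r; lra). lra.
Qed.

Lemma alpha_decr (s s' : R) : 0 < s -> s' < 1 -> s < s' -> alpha q s' < alpha q s.
Proof.
  intros hs hs' hlt. unfold alpha.
  assert (hq : 1 < q) by lra.
  assert (ha := omega_interior q s' hq ltac:(lra)).
  assert (hd := omega_decr q s s' hq ltac:(lra) ltac:(lra) hlt).
  assert (h1 := Rlt_Rpower_l (omega q s') (omega q s) q ltac:(lra) ltac:(lra)).
  assert (h2 := Rpower_pos (omega q s') q).
  assert (h3 : / s' < / s) by (apply Rinv_lt_contravar; nra).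
  assert (h4 : 0 < / s') by (apply Rinv_0_lt_compat; lra).
  unfold Rdiv. nra.
Qed.

(** In terms of [a = omega q s], [alpha] is [q(a - 1) / (q - (q-1)a)]; solving for
    [a] makes [alpha] itself a parameter of the slice. *)
Lemma alpha_param (x : R) : 0 <= x ->
  let a := q * (1 + x) / (q + (q - 1) * x) in
  1 <= a < q / (q - 1) /\ alpha q (H q a) = x /\ 1 / H q a = (1 + x) / Rpower a q
  /\ (0 < x -> 1 < a).
Proof.
  intros hx a. assert (hd : 0 < q + (q - 1) * x) by nra.
  assert (ha : 1 <= a < q / (q - 1)).
  { unfold a. split.
    - apply Rle_div_r; nra.
    - apply Rlt_div_l; [nra|]. unfold Rdiv.
      replace (q * / (q - 1) * (q + (q - 1) * x)) with (q * (q / (q - 1)) + q * x) by (field; lra).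
      assert (hc := conj_gt_1 q ltac:(lra)). nra. }
  assert (hinv : 1 / H q a = (1 + x) / Rpower a q).
  { rewrite H_factor by lra. rewrite (Rpower_pred a q) by lra.
    assert (h1 := Rpower_pos a (q - 1)).
    replace (q - (q - 1) * a) with (a / (1 + x)) by (unfold a; field; lra).
    field. repeat split; lra. }
  split; [exact ha|]. split; [|split; [exact hinv|]].
  - unfold alpha. rewrite omega_H by lra.
    replace (Rpower a q / H q a) with (Rpower a q * (1 / H q a)) by (unfold Rdiv; ring).
    rewrite hinv. assert (h1 := Rpower_pos a q). field. lra.
  - intros hx'. unfold a. apply Rlt_div_r; nra.
Qed.

Lemma ratio_lt_1 (s : R) : admissible s -> 0 < s1 / s < 1.
Proof.
  intros [hs hc]. split; [apply Rdiv_lt_0_compat; lra|]. nra.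
Qed.

Lemma gap_pos (s x : R) : admissible s -> 1 <= x -> 0 < gap s x.
Proof.
  intros hs hx. unfold gap. assert (hc := ratio_lt_1 s hs).
  assert (h1 := Rpower_ge_1 x (p - q)). lra.
Qed.

Lemma gap_incr (s x y : R) : 1 <= x -> x < y -> gap s x < gap s y.
Proof.
  intros hx hxy. unfold gap. assert (hc := Rlt_Rpower_l x y (p - q)). lra.
Qed.

Lemma tau_gap (s x : R) : admissible s -> 1 <= x ->
  p * (tau p q s1 s x * gap s x) = (p - q) * (Rpower x p - s1).
Proof.
  intros hs hx. assert (hg := gap_pos s x hs hx). unfold tau.
  fold (gap s x). field. lra.
Qed.

Lemma tau_pos (s x : R) : admissible s -> 1 <= x -> 0 < tau p q s1 s x.
Proof.
  intros hs hx. assert (hg := gap_pos s x hs hx). unfold tau. fold (gap s x).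
  assert (h1 := Rpower_ge_1 x p).
  apply Rmult_lt_0_compat; apply Rdiv_lt_0_compat; lra.
Qed.

(** The numerator of the derivative of [tau] has the sign of
    [q x^p - p c x^q + (p-q) s1], with [c = s1 / s].  This increases for
    [x >= 1] because [c < 1], and at [x = 1] it is positive by admissibility.
    Quotients are avoided by differentiating the cross-multiplied difference
    [phi], in which [x] is kept fixed. *)
Lemma tau_incr (s x y : R) : admissible s -> 1 <= x -> x < y ->
  tau p q s1 s x < tau p q s1 s y.
Proof.
  intros hs hx hxy.
  assert (hgx := gap_pos s x hs hx). assert (hgy := gap_pos s y hs ltac:(lra)).
  set (c := s1 / s).
  assert (hc : 0 < c < 1) by (apply ratio_lt_1; auto).
  assert (hpos : 0 < q * Rpower x p - p * c * Rpower x q + (p - q) * s1).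
  { set (G := fun z => q * Rpower z p - p * c * Rpower z q).
    assert (hG1 : G 1 = q - p * c) by (unfold G; rewrite !Rpower_one_l; ring).
    assert (hG : G 1 <= G x).
    { destruct hx as [hx|<-]; [left|right; reflexivity].
      apply (increasing_of_deriv G (fun z => p * q * Rpower z (q - 1) * (Rpower z (p - q) - c))); auto.
      - intros z hz. eapply deriv_eq.
        2:{ apply (derivable_pt_lim_minus (fun z => q * Rpower z p) (fun z => p * c * Rpower z q)).
            - apply (derivable_pt_lim_scal (fun z => Rpower z p)).
              apply derivable_pt_lim_power; lra.
            - apply (derivable_pt_lim_scal (fun z => Rpower z q)).
              apply derivable_pt_lim_power; lra. }
        replace (p - 1) with ((q - 1) + (p - q)) by ring. rewrite Rpower_plus. ring.
      - intros z hz. assert (h1 := Rpower_ge_1 z (p - q) ltac:(lra) ltac:(lra)).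
        assert (h2 := Rpower_pos z (q - 1)).
        apply Rmult_lt_0_compat; [|lra]. apply Rmult_lt_0_compat; nra. }
    destruct hs as [hs hadm]. fold c in hadm. unfold G at 2 in hG. lra. }
  set (phi := fun z => (Rpower z p - s1) * gap s x - (Rpower x p - s1) * gap s z).
  assert (hphi : phi x < phi y).
  { apply (increasing_of_deriv phi (fun z => Rpower z (p - q - 1) *
      (p * Rpower z q * gap s x - (p - q) * (Rpower x p - s1)))); auto.
    - intros z hz. unfold phi, gap. eapply deriv_eq.
      2:{ apply (derivable_pt_lim_minus (fun z => (Rpower z p - s1) * (Rpower x (p - q) - s1 / s))
            (fun z => (Rpower x p - s1) * (Rpower z (p - q) - s1 / s))).
          - apply (derivable_pt_lim_mult (fun z => Rpower z p - s1) (fun _ => Rpower x (p - q) - s1 / s)).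
            + apply (derivable_pt_lim_minus (fun z => Rpower z p) (fun _ => s1)).
              * apply derivable_pt_lim_power; lra.
              * apply derivable_pt_lim_const.
            + apply derivable_pt_lim_const.
          - apply (derivable_pt_lim_scal (fun z => Rpower z (p - q) - s1 / s)).
            apply (derivable_pt_lim_minus (fun z => Rpower z (p - q)) (fun _ => s1 / s)).
            + apply derivable_pt_lim_power; lra.
            + apply derivable_pt_lim_const. }
      replace (p - 1) with (p - q - 1 + q) by ring. rewrite Rpower_plus. ring.
    - intros z hz. apply Rmult_lt_0_compat; [apply Rpower_pos|].
      assert (hz1 := Rlt_Rpower_l x z q ltac:(lra) ltac:(lra)).
      assert (hsplit : Rpower x p = Rpower x q * Rpower x (p - q)).
      { rewrite <- Rpower_plus. f_equal; ring. }
      assert (h1 : p * Rpower x q * gap s x - (p - q) * (Rpower x p - s1)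
        = q * Rpower x p - p * c * Rpower x q + (p - q) * s1).
      { unfold gap. fold c. rewrite hsplit. ring. }
      assert (h2 : p * Rpower x q * gap s x < p * Rpower z q * gap s x).
      { apply Rmult_lt_compat_r; auto. apply Rmult_lt_compat_l; lra. }
      lra. }
  assert (hx0 : phi x = 0) by (unfold phi; ring).
  unfold tau. fold (gap s x) (gap s y).
  apply Rmult_lt_compat_l; [apply Rdiv_lt_0_compat; lra|].
  apply Rlt_div_l; auto. unfold Rdiv.
  replace ((Rpower y p - s1) * / gap s y * gap s x) with ((Rpower y p - s1) * gap s x / gap s y)
    by (unfold Rdiv; ring).
  apply Rlt_div_r; auto. unfold phi in *. lra.
Qed.

Lemma tau_at_1 (s : R) : admissible s -> tau p q s1 s 1 < 1.
Proof.
  intros hs. assert (hg := gap_pos s 1 hs ltac:(lra)).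
  assert (h1 := tau_gap s 1 hs ltac:(lra)).
  destruct hs as [hs hc]. rewrite Rpower_one_l in h1.
  assert (h2 : gap s 1 = 1 - s1 / s) by (unfold gap; now rewrite Rpower_one_l).
  rewrite h2 in *. apply (Rmult_lt_reg_r (p * (1 - s1 / s))); [apply Rmult_lt_0_compat; lra|].
  lra.
Qed.

Lemma profile_tau (s x : R) : admissible s -> 1 <= x ->
  (profile x = s1 - p / (p - q) * (s1 / s) <-> tau p q s1 s x = 1).
Proof.
  intros hs hx. assert (hg := gap_pos s x hs hx). assert (h1 := tau_gap s x hs hx).
  assert (h2 : (p - q) * (profile x - (s1 - p / (p - q) * (s1 / s)))
    = p * (tau p q s1 s x * gap s x) - p * gap s x).
  { rewrite h1. unfold profile, gap. field. destruct hs; lra. }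
  split; intros he.
  - rewrite he in h2. apply (Rmult_eq_reg_r (p * gap s x)); [lra|].
    apply Rgt_not_eq, Rmult_lt_0_compat; lra.
  - rewrite he in h2. apply (Rmult_eq_reg_l (p - q)); lra.
Qed.

Lemma profile_incr (x y : R) : 1 <= x -> x < y -> profile x < profile y.
Proof.
  intros hx hxy.
  apply (increasing_of_deriv profile (fun z => p * Rpower z (p - q - 1) * (Rpower z q - 1))); auto.
  - intros z hz. unfold profile. eapply deriv_eq.
    2:{ apply (derivable_pt_lim_minus (fun z => Rpower z p) (fun z => p / (p - q) * Rpower z (p - q))).
        - apply derivable_pt_lim_power; lra.
        - apply (derivable_pt_lim_scal (fun z => Rpower z (p - q))).
          apply derivable_pt_lim_power; lra. }
    replace (p - 1) with (p - q - 1 + q) by ring. rewrite Rpower_plus. field; lra.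
  - intros z hz. assert (h1 := Rpower_pos z (p - q - 1)).
    assert (h2 := Rlt_Rpower_l 1 z q ltac:(lra) ltac:(lra)). rewrite Rpower_one_l in h2.
    apply Rmult_lt_0_compat; nra.
Qed.

Lemma profile_cont (x : R) : 0 < x -> continuity_pt profile x.
Proof.
  intros hx. apply derivable_continuous_pt. unfold profile. eexists.
  apply (derivable_pt_lim_minus (fun z => Rpower z p) (fun z => p / (p - q) * Rpower z (p - q))).
  - now apply derivable_pt_lim_power.
  - apply (derivable_pt_lim_scal (fun z => Rpower z (p - q))).
    now apply derivable_pt_lim_power.
Qed.

Lemma t0_spec (s : R) : admissible s ->
  1 < t0 p q s1 s /\ tau p q s1 s (t0 p q s1 s) = 1.
Proof.
  intros hs. set (v := s1 - p / (p - q) * (s1 / s)).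
  assert (hr := conj_gt_1 q ltac:(lra)).
  assert (hk : 1 < p / (p - q)) by (apply Rlt_div_r; lra).
  (* [X] is the positive zero of [profile]. *)
  set (X := Rpower (p / (p - q)) (1 / q)).
  assert (hq0 : 0 < 1 / q) by (apply Rdiv_lt_0_compat; lra).
  assert (hX : 1 < X).
  { apply Rpower_gt_1; lra. }
  assert (hXv : v < profile X).
  { unfold profile. replace p with ((p - q) + q) at 1 by ring. rewrite Rpower_plus.
    assert (hXq : Rpower X q = p / (p - q)).
    { unfold X. rewrite Rpower_mult. replace (1 / q * q) with 1 by (field; lra).
      apply Rpower_1; lra. }
    rewrite hXq. unfold v. destruct hs as [hs hc].
    assert (s1 < s1 / s) by (apply Rlt_div_r; nra). nra. }
  assert (h1v : profile 1 < v).
  { unfold profile, v. rewrite !Rpower_one_l. destruct hs as [hs hc].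
    apply (Rmult_lt_reg_l (p - q)); [lra|].
    replace ((p - q) * (1 - p / (p - q) * 1)) with (- q) by (field; lra).
    replace ((p - q) * (s1 - p / (p - q) * (s1 / s))) with ((p - q) * s1 - p * (s1 / s))
      by (field; lra).
    lra. }
  destruct (Ranalysis5.IVT_interv (fun z => profile z - v) 1 X) as [z [hz1 hz2]]; try lra.
  { intros z hz. apply (continuity_pt_minus profile (fun _ => v)).
    - apply profile_cont; lra.
    - apply continuity_pt_const. now intros ? ?. }
  assert (hzv : profile z = v) by lra.
  assert (hz : 1 < z).
  { destruct (proj1 hz1) as [|he]; auto. rewrite <- he in hzv. lra. }
  assert (ht : t0 p q s1 s = z).
  { apply iota_eq; [split; [lra|exact hzv]|]. intros y [hy1 hy2].
    assert (hyv : profile y = v) by exact hy2.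
    destruct (Rtotal_order y z) as [hl|[hl|hl]]; auto.
    - assert (hi := profile_incr y z). lra.
    - assert (hi := profile_incr z y). lra. }
  rewrite ht. split; auto. apply profile_tau; auto; lra.
Qed.

Lemma width_spec (s x : R) : admissible s -> 1 <= x ->
  1 <= width s x <= q / (q - 1) /\ H q (width s x) = Rmin 1 (tau p q s1 s x).
Proof.
  intros hs hx. apply omega_spec; [lra|]. split; [|apply Rmin_l].
  apply Rlt_le, Rmin_glb_lt; [lra|]. now apply tau_pos.
Qed.

Lemma width_at_1 (s x : R) : tau p q s1 s x = 1 -> width s x = 1.
Proof.
  intros he. unfold width. rewrite he, Rmin_left by lra. apply omega_at_1; lra.
Qed.

Lemma width_anti (s x y : R) : admissible s -> 1 <= x -> x < y ->
  width s y <= width s x.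
Proof.
  intros hs hx hxy. assert (hi := tau_incr s x y hs hx hxy).
  assert (h0 := tau_pos s x hs hx).
  unfold width. destruct (Rle_or_lt 1 (tau p q s1 s x)) as [hl|hl].
  - rewrite !Rmin_left by lra. lra.
  - left. apply omega_decr; try lra.
    + apply Rlt_le, Rmin_glb_lt; lra.
    + apply Rmin_l.
    + rewrite (Rmin_right 1 (tau p q s1 s x)) by lra. apply Rmin_glb_lt; lra.
Qed.

(** [(q-1)] times this function of [w] is [(p-1) H_q(w) - (p-q) w^(q-1)], a sum
    of two decreasing functions. *)
Lemma coef_anti (w v : R) : 1 <= w <= v ->
  p * Rpower v (q - 1) - (p - 1) * Rpower v q
  <= p * Rpower w (q - 1) - (p - 1) * Rpower w q.
Proof.
  intros [hw [hwv|<-]]; [|lra].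
  assert (hd := H_decr q w v ltac:(lra) hw hwv). unfold H in hd.
  assert (hi := Rlt_Rpower_l w v (q - 1) ltac:(lra) ltac:(lra)).
  assert (h1 : forall z, (q - 1) * (p * Rpower z (q - 1) - (p - 1) * Rpower z q)
    = (p - 1) * (- (q - 1) * Rpower z q + q * Rpower z (q - 1)) - (p - q) * Rpower z (q - 1))
    by (intros; ring).
  apply (Rmult_le_reg_l (q - 1)); [lra|]. rewrite !h1.
  apply Rplus_le_compat; [apply Rmult_le_compat_l; lra|].
  apply Ropp_le_contravar, Rmult_le_compat_l; lra.
Qed.

Lemma lhs_incr (s x y : R) : admissible s -> 1 <= x -> x < y ->
  0 < lhs s x -> lhs s x < lhs s y.
Proof.
  intros hs hx hxy hp0. unfold lhs in *. cbv zeta in *.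
  assert (hw := width_anti s x y hs hx hxy).
  destruct (width_spec s y hs ltac:(lra)) as [hy _].
  assert (hg := gap_pos s x hs hx). assert (hgi := gap_incr s x y hx hxy).
  assert (hc := coef_anti (width s y) (width s x) ltac:(lra)).
  set (cx := p * Rpower (width s x) (q - 1) - (p - 1) * Rpower (width s x) q) in *.
  set (cy := p * Rpower (width s y) (q - 1) - (p - 1) * Rpower (width s y) q) in *.
  assert (hcx : 0 < cx).
  { apply (Rmult_lt_reg_r (q * gap s x)); [apply Rmult_lt_0_compat; lra|]. lra. }
  rewrite !Rmult_assoc. apply Rmult_lt_compat_l; [lra|].
  apply Rlt_le_trans with (cx * gap s y).
  - apply Rmult_lt_compat_l; lra.
  - apply Rmult_le_compat_r; lra.
Qed.

(** Subtracting the defining relation of [tau] removes [w^(q-1)] from the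
    equation and leaves relation (2) of the introduction. *)
Lemma lhs_rhs (s x : R) : admissible s -> 1 <= x -> tau p q s1 s x <= 1 ->
  lhs s x - rhs s = (p - q) *
    (Rpower x p - Rpower (width s x) q * gap s x - s1 * (1 + alpha q s)).
Proof.
  intros hs hx ht. assert (hg := tau_gap s x hs hx).
  destruct (width_spec s x hs hx) as [_ hw]. rewrite Rmin_right in hw by lra.
  rewrite <- hw in hg. unfold H in hg. unfold lhs, rhs. cbv zeta.
  set (W := Rpower (width s x) q) in *. set (W1 := Rpower (width s x) (q - 1)) in *.
  replace (q * (p * W1 - (p - 1) * W) * gap s x)
    with (p * ((- (q - 1) * W + q * W1) * gap s x) - (p - q) * (W * gap s x)) by ring.
  rewrite hg. ring.
Qed.

Lemma rhs_pos (s : R) : 0 < s < 1 -> 0 < rhs s.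
Proof.
  intros hs. unfold rhs. assert (ha := alpha_pos s hs).
  apply Rmult_lt_0_compat; auto. apply Rmult_lt_0_compat; lra.
Qed.

Lemma lhs_at_1 (s : R) : admissible s -> lhs s 1 < rhs s.
Proof.
  intros hs. assert (ht := tau_at_1 s hs).
  assert (hl := lhs_rhs s 1 hs ltac:(lra) ltac:(lra)).
  destruct (width_spec s 1 hs ltac:(lra)) as [hw _].
  assert (hW := Rpower_ge_1 (width s 1) q ltac:(lra) ltac:(lra)).
  rewrite Rpower_one_l in hl.
  assert (hg := gap_pos s 1 hs ltac:(lra)).
  assert (h1 : 1 - s1 / s = gap s 1) by (unfold gap; now rewrite Rpower_one_l).
  assert (h2 : s1 / s < s1 * (1 + alpha q s)).
  { unfold alpha. destruct hs as [hs _].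
    assert (ha := omega_interior q s ltac:(lra) hs).
    assert (h3 := Rlt_Rpower_l 1 (omega q s) q ltac:(lra) ltac:(lra)).
    rewrite Rpower_one_l in h3.
    replace (s1 * (1 + (Rpower (omega q s) q / s - 1))) with (s1 / s * Rpower (omega q s) q)
      by (field; lra).
    assert (0 < s1 / s) by (apply Rdiv_lt_0_compat; lra). nra. }
  assert (h3 : gap s 1 <= Rpower (width s 1) q * gap s 1) by nra.
  assert (h4 : 1 - Rpower (width s 1) q * gap s 1 - s1 * (1 + alpha q s) < 0) by lra.
  nra.
Qed.

(** * The boundary between the two branches *)

(** If [N] and [M] are the bases in [h = N^p / M^(p-q)], the hypothesis reads
    [(s1 N)^p = (s1 M)^(p-q)], so some [T] satisfies [T^p = s1 M] and
    [T^(p-q) = s1 N]; these say that [T] solves the [t0] equation and, with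
    [w = 1], the equation of the other branch. *)
Lemma level_root (s : R) : 0 < s < 1 -> h p q s = 1 / Rpower s1 q ->
  exists T, 1 < T /\ profile T = s1 - p / (p - q) * (s1 / s) /\
    Rpower T p = s1 * (1 + p / q * alpha q s).
Proof.
  intros hs hh. assert (ha := alpha_pos s hs).
  set (N := 1 / s + (p - q) / q * alpha q s).
  set (M := 1 + p / q * alpha q s).
  assert (hpq1 : 0 < p / q) by (apply Rdiv_lt_0_compat; lra).
  assert (hpq2 : 0 < (p - q) / q) by (apply Rdiv_lt_0_compat; lra).
  assert (hM : 0 < M) by (unfold M; nra).
  assert (hs' : 0 < 1 / s) by (apply Rdiv_lt_0_compat; lra).
  assert (hN : 0 < N) by (unfold N; nra).
  assert (hNM : N < M).
  { cut (1 / s < 1 + alpha q s).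
    { intros hd. cut (0 < M - N); [lra|].
      replace (M - N) with (1 + alpha q s - 1 / s) by (unfold M, N; field; lra). lra. }
    unfold alpha. assert (hw := omega_interior q s ltac:(lra) hs).
    assert (h3 := Rlt_Rpower_l 1 (omega q s) q ltac:(lra) ltac:(lra)).
    rewrite Rpower_one_l in h3. unfold Rdiv in *. rewrite Rmult_1_l in *. nra. }
  assert (heq : Rpower (s1 * N) p = Rpower (s1 * M) (p - q)).
  { unfold h in hh. fold N M in hh.
    rewrite <- !Rpower_mult_distr by lra.
    replace p with (p - q + q) at 1 by ring. rewrite Rpower_plus.
    assert (h1 := Rpower_pos s1 q). assert (h2 := Rpower_pos M (p - q)).
    assert (h3 : Rpower N p = Rpower M (p - q) / Rpower s1 q).
    { apply (Rmult_eq_reg_r (/ Rpower M (p - q))); [|apply Rinv_neq_0_compat; lra].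
      unfold Rdiv in hh. rewrite hh. field. lra. }
    rewrite h3. field. lra. }
  assert (hsM : 0 < s1 * M) by nra. assert (hsN : 0 < s1 * N) by nra.
  set (T := Rpower (s1 * M) (1 / p)).
  assert (hT0 : 0 < T) by apply Rpower_pos.
  assert (hTp : Rpower T p = s1 * M).
  { unfold T. rewrite Rpower_mult. replace (1 / p * p) with 1 by (field; lra).
    now apply Rpower_1. }
  assert (hTr : Rpower T (p - q) = s1 * N).
  { apply (Rpower_inj _ _ p); [lra|apply Rpower_pos|auto|].
    rewrite heq, <- hTp, !Rpower_mult. f_equal; ring. }
  assert (hT : 1 < T).
  { assert (hsplit : Rpower T p = Rpower T (p - q) * Rpower T q)
      by (rewrite <- Rpower_plus; f_equal; ring).
    apply (Rpower_lt_iff 1 T q); try lra. rewrite Rpower_one_l.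
    apply (Rmult_lt_reg_l (s1 * N)); [lra|].
    rewrite <- hTr at 2. rewrite <- hsplit, hTp. nra. }
  exists T. split; [auto|]. split; [|exact hTp].
  unfold profile. rewrite hTp, hTr. unfold M, N. field. lra.
Qed.

(** Intermediate values in the parameter [x = alpha q s] for
    [psi x = p ln (s1 N) - (p-q) ln (s1 M)], which vanishes exactly at the
    wanted level.  At [x = 0] it is [q ln s1 < 0]. *)
Lemma level_exists : exists s, 0 < s < 1 /\ h p q s = 1 / Rpower s1 q.
Proof.
  set (k := (p - q) / p).
  assert (hk : 0 < k < 1).
  { unfold k; split; [apply Rdiv_lt_0_compat|apply Rlt_div_l]; lra. }
  (* [N >= k M], so [psi >= 0] once [k^p (s1 M)^q >= 1]: [Mx] is the value of
     [M] with equality, reached at [x = X]. *)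
  set (Mx := Rpower k (- p / q) / s1).
  assert (hkp : 1 < Rpower k (- p / q)).
  { replace (- p / q) with (- (p / q)) by (field; lra). rewrite Rpower_Ropp.
    assert (h1 := Rpower_pos k (p / q)).
    assert (h2 : Rpower k (p / q) < 1).
    { apply Rpower_lt_1; [lra|apply Rdiv_lt_0_compat; lra]. }
    rewrite <- Rinv_1 at 1. apply Rinv_lt_contravar; lra. }
  assert (hMx : 1 < Mx) by (unfold Mx; apply Rlt_div_r; lra).
  set (X := (Mx - 1) * q / p).
  assert (hX : 0 < X) by (unfold X; apply Rdiv_lt_0_compat; nra).
  set (a := fun x => q * (1 + x) / (q + (q - 1) * x)).
  set (N := fun x => (1 + x) / Rpower (a x) q + (p - q) / q * x).
  set (M := fun x => 1 + p / q * x).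
  assert (hpq1 : 0 < p / q) by (apply Rdiv_lt_0_compat; lra).
  assert (hpq2 : 0 < (p - q) / q) by (apply Rdiv_lt_0_compat; lra).
  assert (hpar := alpha_param). cbv zeta in hpar.
  assert (hN : forall x, 0 <= x -> k * M x <= N x /\ 0 < N x /\ 0 < M x).
  { intros x hx. destruct (hpar x hx) as [ha [_ [hinv _]]]. fold (a x) in *.
    assert (hH : 0 < H q (a x) <= 1).
    { split.
      - rewrite <- (H_at_conj q) by lra. apply H_decr; lra.
      - destruct (proj1 ha) as [hl|hl]; [|rewrite <- hl, H_at_1; lra].
        rewrite <- (H_at_1 q). left; apply H_decr; lra. }
    assert (h1 : 1 <= 1 / H q (a x)) by (apply Rle_div_r; lra).
    unfold N, M. rewrite <- hinv.
    replace (k * (1 + p / q * x)) with (k + (p - q) / q * x) by (unfold k; field; lra).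
    repeat split; nra. }
  set (psi := fun x => p * ln (s1 * N x) - (p - q) * ln (s1 * M x)).
  assert (hz : exists x, 0 < x /\ psi x = 0).
  { assert (h0 : psi 0 < 0).
    { unfold psi, N, M. replace (a 0) with 1 by (unfold a; field; lra).
      rewrite Rpower_one_l. replace (s1 * ((1 + 0) / 1 + (p - q) / q * 0)) with s1 by (field; lra).
      replace (s1 * (1 + p / q * 0)) with s1 by ring.
      assert (hl := ln_increasing s1 1 ltac:(lra) ltac:(lra)). rewrite ln_1 in hl. nra. }
    assert (hX' : 0 <= psi X).
    { unfold psi. destruct (hN X ltac:(lra)) as [h1 [h2 h3]].
      assert (hMX : M X = Mx) by (unfold M, X; field; lra).
      assert (hl : ln (s1 * (k * M X)) <= ln (s1 * N X)) 
        by (apply ln_le; [apply Rmult_lt_0_compat; [|apply Rmult_lt_0_compat]; lra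
                         |apply Rmult_le_compat_l; lra]).
      assert (hs1M : s1 * M X = Rpower k (- p / q)) by (rewrite hMX; unfold Mx; field; lra).
      replace (s1 * (k * M X)) with (k * (s1 * M X)) in hl by ring.
      rewrite hs1M in *. rewrite ln_mult in hl by lra.
      assert (hlr : ln (Rpower k (- p / q)) = - p / q * ln k) by (unfold Rpower; apply ln_exp).
      rewrite hlr in *.
      assert (he : p * (ln k + - p / q * ln k) - (p - q) * (- p / q * ln k) = 0) by (field; lra).
      assert (p * (ln k + - p / q * ln k) <= p * ln (s1 * N X)) by (apply Rmult_le_compat_l; lra).
      lra. }
    destruct hX' as [hX'|hX']; [|exists X; auto].
    assert (hcont : forall x, 0 <= x <= X -> continuity_pt psi x).
    { intros x hx. destruct (hN x ltac:(lra)) as [_ [h2 h3]].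
      destruct (hpar x ltac:(lra)) as [ha _]. fold (a x) in ha.
      assert (hd : 0 < q + (q - 1) * x) by nra.
      assert (hca : limit1_in a (D_x no_cond x) (a x) x).
      { apply lim_div; [| |lra].
        - apply limit_mul; [apply lim_const|]. apply limit_plus; [apply lim_const|apply lim_x].
        - apply limit_plus; [apply lim_const|]. apply limit_mul; [apply lim_const|apply lim_x]. }
      assert (hcN : limit1_in N (D_x no_cond x) (N x) x).
      { apply limit_plus; [|apply limit_mul; [apply lim_const|apply lim_x]].
        apply lim_div; [apply limit_plus; [apply lim_const|apply lim_x]| |apply Rgt_not_eq, Rpower_pos].
        apply (lim_cont (fun z => Rpower z q)); [|exact hca].
        apply derivable_continuous_pt. eexists. apply derivable_pt_lim_power; lra. }
      assert (hcM : limit1_in M (D_x no_cond x) (M x) x).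
      { apply limit_plus; [apply lim_const|apply limit_mul; [apply lim_const|apply lim_x]]. }
      assert (hln : forall z, 0 < z -> continuity_pt ln z).
      { intros z hz. apply derivable_continuous_pt. eexists. now apply derivable_pt_lim_ln. }
      apply lim_pt. unfold psi.
      apply limit_minus; (apply limit_mul; [apply lim_const|]);
        apply (lim_cont ln); try (apply hln; nra);
        (apply limit_mul; [apply lim_const|auto]). }
    destruct (Ranalysis5.IVT_interv psi 0 X hcont hX h0 hX') as [x [hx1 hx2]].
    exists x. split; auto. destruct (proj1 hx1) as [|he]; auto. rewrite <- he in hx2. lra. }
  destruct hz as [x [hx0 hx]].
  destruct (hpar x ltac:(lra)) as [ha [hal [hinv ha1]]]. fold (a x) in *.
  destruct (hN x ltac:(lra)) as [_ [h2 h3]].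
  exists (H q (a x)). split.
  - split; [rewrite <- (H_at_conj q) by lra|rewrite <- (H_at_1 q)]; apply H_decr; auto; lra.
  - unfold h. rewrite hal, hinv. fold (N x) (M x).
    assert (hexp : Rpower (s1 * N x) p = Rpower (s1 * M x) (p - q)).
    { unfold Rpower. f_equal. unfold psi in hx. lra. }
    rewrite <- !Rpower_mult_distr in hexp by lra.
    replace p with (p - q + q) in hexp at 1 by ring. rewrite Rpower_plus in hexp.
    assert (e1 := Rpower_pos s1 q). assert (e2 := Rpower_pos (M x) (p - q)).
    assert (e3 := Rpower_pos s1 (p - q)).
    apply (Rmult_eq_reg_l (Rpower s1 (p - q) * Rpower s1 q * Rpower (M x) (p - q))).
    + transitivity (Rpower s1 (p - q) * Rpower s1 q * Rpower (N x) p); [field; lra|].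
      rewrite hexp. field. lra.
    + apply Rgt_not_eq. apply Rmult_lt_0_compat; auto. now apply Rmult_lt_0_compat.
Qed.

(** Along solutions of the [t0] equation, [T] increases with [s] while [alpha]
    decreases: hence the boundary point is unique, and the branch at [s] is
    decided by its position relative to it. *)
Lemma level_anti (s s' T T' : R) : 0 < s -> s' < 1 -> s < s' -> 1 <= T -> 1 <= T' ->
  profile T = s1 - p / (p - q) * (s1 / s) ->
  profile T' = s1 - p / (p - q) * (s1 / s') ->
  Rpower T p - s1 * (1 + p / q * alpha q s)
  < Rpower T' p - s1 * (1 + p / q * alpha q s').
Proof.
  intros hs hs' hlt hT hT' he he'.
  assert (hk : 1 < p / (p - q)) by (apply Rlt_div_r; lra).
  assert (hc : s1 / s' < s1 / s).
  { apply Rmult_lt_compat_l; [lra|]. apply Rinv_lt_contravar; nra. }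
  assert (hpr : profile T < profile T') by (rewrite he, he'; nra).
  assert (hTT : T < T').
  { destruct (Rlt_or_le T T') as [|[hl|hl]]; auto.
    - assert (hi := profile_incr T' T). lra.
    - subst. lra. }
  assert (h1 := Rlt_Rpower_l T T' p ltac:(lra) ltac:(lra)).
  assert (ha := alpha_decr s s' hs hs' hlt).
  assert (hpq1 : 0 < p / q) by (apply Rdiv_lt_0_compat; lra).
  assert (s1 * (p / q) * alpha q s' < s1 * (p / q) * alpha q s)
    by (apply Rmult_lt_compat_l; nra).
  lra.
Qed.

Definition s_crit : R := h_inv p q (1 / Rpower s1 q).

Lemma s_crit_spec : 0 < s_crit < 1 /\ h p q s_crit = 1 / Rpower s1 q.
Proof.
  destruct level_exists as [s [hs hh]].
  assert (he : s_crit = s).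
  { apply iota_eq; [auto|]. intros y [hy hhy].
    destruct (level_root s hs hh) as [T [h1 [h2 h3]]].
    destruct (level_root y hy hhy) as [T' [h1' [h2' h3']]].
    destruct (Rtotal_order y s) as [hl|[hl|hl]]; auto.
    - assert (hi := level_anti y s T' T). lra.
    - assert (hi := level_anti s y T T'). lra. }
  rewrite he. auto.
Qed.

Lemma lhs_at_t0 (s : R) : admissible s ->
  (s < s_crit -> lhs s (t0 p q s1 s) < rhs s) /\
  (s = s_crit -> lhs s (t0 p q s1 s) = rhs s) /\
  (s_crit < s -> rhs s < lhs s (t0 p q s1 s)).
Proof.
  intros hs. destruct (t0_spec s hs) as [ht1 ht2].
  destruct s_crit_spec as [hc hhc].
  destruct (level_root s_crit hc hhc) as [T [hT1 [hT2 hT3]]].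
  assert (hpf : profile (t0 p q s1 s) = s1 - p / (p - q) * (s1 / s))
    by (apply profile_tau; auto; lra).
  assert (hl := lhs_rhs s (t0 p q s1 s) hs ltac:(lra) ltac:(lra)).
  rewrite (width_at_1 s _ ht2), Rpower_one_l in hl.
  assert (hg := tau_gap s (t0 p q s1 s) hs ltac:(lra)). rewrite ht2 in hg.
  set (t := t0 p q s1 s) in *.
  assert (hd : lhs s t - rhs s
    = (p - q) * q / p * (Rpower t p - s1 * (1 + p / q * alpha q s))).
  { rewrite hl. replace (gap s t) with ((p - q) * (Rpower t p - s1) / p)
      by (rewrite <- hg; field; lra). field. lra. }
  assert (hk : 0 < (p - q) * q / p) by (apply Rdiv_lt_0_compat; nra).
  destruct hs as [hs hadm].
  repeat split; intros hlt.
  - assert (hi := level_anti s s_crit t T). nra.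
  - subst s. assert (t = T).
    { destruct (Rtotal_order t T) as [hh|[hh|hh]]; auto.
      - assert (hi := profile_incr t T). lra.
      - assert (hi := profile_incr T t). lra. }
    subst T. rewrite hT3 in hd. lra.
  - assert (hi := level_anti s_crit s T t). nra.
Qed.

(** * Continuity and differentiability of the data *)

Lemma tau_lim (u v : R -> R) (S : R -> Prop) (s x r : R) :
  s <> 0 -> 0 < x -> gap s x <> 0 ->
  limit1_in u S s r -> limit1_in v S x r ->
  limit1_in (fun o => gap (u o) (v o)) S (gap s x) r /\
  limit1_in (fun o => tau p q s1 (u o) (v o)) S (tau p q s1 s x) r.
Proof.
  intros hs hx hg hu hv.
  assert (hpow : forall e, limit1_in (fun o => Rpower (v o) e) S (Rpower x e) r).
  { intros e. apply (lim_cont (fun z => Rpower z e)); [|exact hv].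
    apply derivable_continuous_pt. eexists. now apply derivable_pt_lim_power. }
  assert (hgl : limit1_in (fun o => gap (u o) (v o)) S (gap s x) r).
  { unfold gap. apply limit_minus; [apply hpow|].
    apply lim_div; [apply lim_const|exact hu|exact hs]. }
  split; [exact hgl|]. unfold tau. fold (gap s x).
  apply limit_mul; [apply lim_const|].
  apply lim_div; [|exact hgl|exact hg].
  apply limit_minus; [apply hpow|apply lim_const].
Qed.

Lemma width_lim (u v : R -> R) (S : R -> Prop) (s x r : R) :
  s <> 0 -> 0 < x -> gap s x <> 0 -> 0 < tau p q s1 s x ->
  limit1_in u S s r -> limit1_in v S x r ->
  limit1_in (fun o => width (u o) (v o)) S (width s x) r.
Proof.
  intros hs hx hg ht hu hv.
  destruct (tau_lim u v S s x r hs hx hg hu hv) as [_ htl].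
  unfold width. apply (lim_cont (fun z => omega q (Rmin 1 z))); [|exact htl].
  apply omega_clamp_cont; lra.
Qed.

Lemma lhs_lim (u v : R -> R) (S : R -> Prop) (s x r : R) :
  admissible s -> 1 <= x ->
  limit1_in u S s r -> limit1_in v S x r ->
  limit1_in (fun o => lhs (u o) (v o)) S (lhs s x) r.
Proof.
  intros hs hx hu hv.
  assert (hg := gap_pos s x hs hx). assert (ht := tau_pos s x hs hx).
  assert (hs0 : s <> 0) by (destruct hs; lra).
  destruct (width_spec s x hs hx) as [hw _].
  assert (hwl := width_lim u v S s x r hs0 ltac:(lra) ltac:(lra) ht hu hv).
  destruct (tau_lim u v S s x r hs0 ltac:(lra) ltac:(lra) hu hv) as [hgl _].
  assert (hpow : forall e,
    limit1_in (fun o => Rpower (width (u o) (v o)) e) S (Rpower (width s x) e) r).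
  { intros e. apply (lim_cont (fun z => Rpower z e)); [|exact hwl].
    apply derivable_continuous_pt. eexists. apply derivable_pt_lim_power; lra. }
  unfold lhs. cbv zeta. apply limit_mul; [|exact hgl].
  apply limit_mul; [apply lim_const|].
  apply limit_minus; (apply limit_mul; [apply lim_const|apply hpow]).
Qed.

Lemma alpha_deriv (s : R) : 0 < s < 1 ->
  let a := omega q s in
  derivable_pt_lim (alpha q) s (- (Rpower a q / ((q - 1) * (a - 1))) / s ^ 2).
Proof.
  intros hs a. assert (ha := omega_interior q s ltac:(lra) hs). fold a in ha.
  assert (hH : s = H q a) by (symmetry; apply omega_spec; lra).
  rewrite H_factor in hH by lra.
  unfold alpha. eapply deriv_eq.
  2:{ apply (derivable_pt_lim_minus (fun z => Rpower (omega q z) q / z) (fun _ => 1)).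
      - apply (derivable_pt_lim_div (fun z => Rpower (omega q z) q) (fun z => z)); [| |lra].
        + apply (derivable_pt_lim_comp (omega q) (fun z => Rpower z q)).
          * apply omega_deriv; lra.
          * apply derivable_pt_lim_power; fold a; lra.
        + apply derivable_pt_lim_id.
      - apply derivable_pt_lim_const. }
  fold a. unfold Rsqr.
  assert (hu := Rpower_pos a (q - 2)).
  rewrite (Rpower_pred a q), (Rpower_pred a (q - 1)) by lra.
  rewrite (Rpower_pred a (q - 1)) in hH by lra.
  replace (q - 1 - 1) with (q - 2) in * by ring.
  set (u := Rpower a (q - 2)) in *. clearbody u.
  assert (hnum : q * (a * u) * (1 / (q * (q - 1) * (u * (1 - a)))) * s - 1 * (a * (a * u))
    = - (a * (a * u) / ((q - 1) * (a - 1)))).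
  { rewrite hH. field. lra. }
  rewrite hnum. field. lra.
Qed.

(** * The function t: sign characterization and continuity *)

(** Both branches at once; on the boundary [s = s_crit] both equations hold. *)
Definition t_spec_at (s x : R) : Prop :=
  1 < x /\ tau p q s1 s x <= 1 /\ lhs s x <= rhs s /\
  (s_crit <= s -> lhs s x = rhs s) /\ (s <= s_crit -> tau p q s1 s x = 1).

Lemma t_equation_lhs (s x : R) : tau p q s1 s x <= 1 ->
  (t_equation p q s1 s x <-> lhs s x = rhs s).
Proof.
  intros ht. unfold t_equation, lhs, rhs, width. cbv zeta.
  rewrite Rmin_right by exact ht. unfold gap. tauto.
Qed.

Lemma t_spec (s : R) : admissible s -> t_spec_at s (t p q s1 s).
Proof.
  intros hs. destruct (t0_spec s hs) as [h0 h1].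
  destruct (lhs_at_t0 s hs) as [hlt [heq hgt]].
  assert (hr := rhs_pos s (proj1 hs)).
  unfold t. fold s_crit. destruct (Rle_dec s_crit s) as [hle|hnle].
  2:{ assert (hl := hlt ltac:(lra)). repeat split; intros; lra. }
  assert (hx : exists x, 1 < x <= t0 p q s1 s /\ lhs s x = rhs s /\
    (s <= s_crit -> tau p q s1 s x = 1)).
  { destruct hle as [hl|hl].
    2:{ exists (t0 p q s1 s). split; [lra|]. split; [apply heq; lra|]. intros _; lra. }
    assert (hgt' := hgt hl). assert (hl1 := lhs_at_1 s hs).
    destruct (Ranalysis5.IVT_interv (fun z => lhs s z - rhs s) 1 (t0 p q s1 s))
      as [x [hx1 hx2]]; try lra.
    - intros x hx. apply lim_pt. apply limit_minus; [|apply lim_const].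
      apply lhs_lim; [auto|lra|apply lim_const|apply lim_x].
    - exists x. split; [|split; [lra|intros; lra]]. split; [|lra].
      destruct (proj1 hx1) as [|he]; auto. subst x. lra. }
  destruct hx as [x [hx1 [hx2 hx3]]].
  assert (htau : forall y, 1 <= y <= t0 p q s1 s -> tau p q s1 s y <= 1).
  { intros y [hy1 [hy2|hy2]]; [|subst y; lra].
    assert (hi := tau_incr s y (t0 p q s1 s) hs hy1 hy2). lra. }
  match goal with |- t_spec_at s ?i => assert (hiota : i = x) end.
  { apply iota_eq.
    - split; [lra|]. apply t_equation_lhs; auto. apply htau; lra.
    - intros y [hy1 hy2]. apply t_equation_lhs in hy2; [|apply htau; lra].
      destruct (Rtotal_order y x) as [hh|[hh|hh]]; auto.
      + assert (hi := lhs_incr s y x hs). lra.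
      + assert (hi := lhs_incr s x y hs). lra. }
  rewrite hiota. assert (htx := htau x ltac:(lra)). repeat split; auto; lra.
Qed.

Lemma before_t (s x y : R) : admissible s -> t_spec_at s y -> 1 <= x ->
  (x < y <-> tau p q s1 s x < 1 /\ lhs s x < rhs s).
Proof.
  intros hs [hy1 [hy2 [hy3 [hy4 hy5]]]] hx.
  assert (hr := rhs_pos s (proj1 hs)). split.
  - intros hxy. assert (ht := tau_incr s x y hs hx hxy). split; [lra|].
    destruct (Rlt_or_le (lhs s x) (rhs s)) as [|hl]; auto.
    assert (hi := lhs_incr s x y hs hx hxy). lra.
  - intros [h1 h2]. destruct (Rlt_or_le x y) as [|[hl|hl]]; auto.
    + destruct (Rle_or_lt s_crit s) as [hc|hc].
      * assert (hi := lhs_incr s y x hs). lra.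
      * assert (hi := tau_incr s y x hs). lra.
    + subst y. destruct (Rle_or_lt s_crit s) as [hc|hc]; lra.
Qed.

Lemma after_t (s x y : R) : admissible s -> t_spec_at s y -> 1 <= x ->
  (y < x <-> 1 < tau p q s1 s x \/ rhs s < lhs s x).
Proof.
  intros hs [hy1 [hy2 [hy3 [hy4 hy5]]]] hx.
  assert (hr := rhs_pos s (proj1 hs)). split.
  - intros hxy. destruct (Rle_or_lt s_crit s) as [hc|hc].
    + right. assert (hi := lhs_incr s y x hs). lra.
    + left. assert (hi := tau_incr s y x hs). lra.
  - intros h1. destruct (Rlt_or_le y x) as [|[hl|hl]]; auto.
    + assert (ht := tau_incr s x y hs hx hl). assert (hi := lhs_incr s x y hs hx hl). lra.
    + subst y. lra.
Qed.

Lemma alpha_cont (s : R) : 0 < s < 1 -> continuity_pt (alpha q) s.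
Proof.
  intros hs. apply derivable_continuous_pt. eexists. now apply alpha_deriv.
Qed.

(** For fixed [x], the conditions deciding the position of [x] relative to [t]
    are strict inequalities between functions continuous in [s]. *)
Lemma t_cont (s : R) : admissible s ->
  limit1_in (t p q s1) admissible (t p q s1 s) s.
Proof.
  intros hs. assert (hspec := t_spec s hs).
  assert (hs0 : s <> 0) by (destruct hs; lra).
  assert (hlim : forall x, 1 <= x ->
    limit1_in (fun o => tau p q s1 o x) admissible (tau p q s1 s x) s /\
    limit1_in (fun o => rhs o - lhs o x) admissible (rhs s - lhs s x) s).
  { intros x hx. assert (hg := gap_pos s x hs hx). split.
    - apply (tau_lim (fun o => o) (fun _ => x)); [auto|lra|lra|apply lim_x|apply lim_const].
    - apply limit_minus.
      + apply limit_mul; [apply lim_const|]. apply (lim_cont (alpha q)); [|apply lim_x].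
        apply alpha_cont. apply hs.
      + apply (lhs_lim (fun o => o) (fun _ => x)); [auto|lra|apply lim_x|apply lim_const]. }
  set (y := t p q s1 s) in *. assert (hy : 1 < y) by apply hspec.
  intros eps he.
  assert (hlo : exists d, 0 < d /\ forall o, admissible o -> Rabs (o - s) < d ->
    y - eps < t p q s1 o).
  { set (x := Rmax 1 (y - eps / 2)).
    assert (hx1 : 1 <= x) by apply Rmax_l.
    assert (hx2 : y - eps / 2 <= x) by apply Rmax_r.
    assert (hx3 : x < y) by (apply Rmax_lub_lt; lra).
    destruct (proj1 (before_t s x y hs hspec hx1) hx3) as [h1 h2].
    destruct (hlim x hx1) as [l1 l2].
    destruct (lim_lt_near _ _ _ _ 1 l1 h1) as [d1 [hd1 hd1']].
    destruct (lim_gt_near _ _ _ _ 0 l2 ltac:(lra)) as [d2 [hd2 hd2']].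
    exists (Rmin d1 d2). split; [apply Rmin_glb_lt; auto|]. intros o ho1 ho2.
    assert (m1 := Rmin_l d1 d2). assert (m2 := Rmin_r d1 d2).
    assert (e1 := hd1' o ho1 ltac:(lra)). assert (e2 := hd2' o ho1 ltac:(lra)).
    assert (e3 := proj2 (before_t o x _ ho1 (t_spec o ho1) hx1) ltac:(lra)). lra. }
  assert (hhi : exists d, 0 < d /\ forall o, admissible o -> Rabs (o - s) < d ->
    t p q s1 o < y + eps).
  { set (x := y + eps / 2). assert (hx1 : 1 <= x) by (unfold x; lra).
    destruct (hlim x hx1) as [l1 l2].
    destruct (proj1 (after_t s x y hs hspec hx1) ltac:(unfold x; lra)) as [hh|hh].
    - destruct (lim_gt_near _ _ _ _ 1 l1 hh) as [d [hd hd']].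
      exists d. split; auto. intros o ho1 ho2. assert (e1 := hd' o ho1 ho2).
      assert (e3 := proj2 (after_t o x _ ho1 (t_spec o ho1) hx1) ltac:(lra)).
      unfold x in e3; lra.
    - destruct (lim_lt_near _ _ _ _ 0 l2 ltac:(lra)) as [d [hd hd']].
      exists d. split; auto. intros o ho1 ho2. assert (e1 := hd' o ho1 ho2).
      assert (e3 := proj2 (after_t o x _ ho1 (t_spec o ho1) hx1) ltac:(lra)).
      unfold x in e3; lra. }
  destruct hlo as [d1 [h1 h2]]. destruct hhi as [d2 [h3 h4]].
  exists (Rmin d1 d2). split; [apply Rmin_glb_lt; auto|]. intros o [ho1 ho2].
  unfold R_met, dist, Rdist in *; simpl in *.
  assert (m1 := Rmin_l d1 d2). assert (m2 := Rmin_r d1 d2).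
  assert (e1 := h2 o ho1 ltac:(lra)). assert (e2 := h4 o ho1 ltac:(lra)).
  apply Rabs_def1; lra.
Qed.

(** * The derivative *)

Definition t_den (x w : R) : R :=
  Rpower x q * (q * (p - 1) * w - p * (q - 1)) - (p - q) * Rpower w q.

Definition t_deriv (s x w a : R) : R :=
  s1 / s ^ 2 * (Rpower w q - (w - 1) * (Rpower a q / (a - 1)))
  / (Rpower x (p - q - 1) * t_den x w).

(** As [t > 1], it suffices that [(p-q) w^q <= q(p-1)w - p(q-1)].  This is an
    equality at [w = 1], and the quotient [m] of the right side by [w^q]
    increases as long as [w <= p / (p - 1)]. *)
Lemma t_den_pos (x w : R) : 1 < x -> 1 <= w -> 0 < p - (p - 1) * w ->
  0 < t_den x w.
Proof.
  intros hx hw hwp.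
  set (m := fun z => (q * (p - 1) * z - p * (q - 1)) * Rpower z (- q)).
  assert (hm : p - q <= m w).
  { assert (hm1 : m 1 = p - q) by (unfold m; rewrite Rpower_one_l; ring).
    rewrite <- hm1. destruct hw as [hw|<-]; [left|right; reflexivity].
    apply (increasing_of_deriv m
      (fun z => q * (q - 1) * Rpower z (- q - 1) * (p - (p - 1) * z))); auto.
    - intros z hz. unfold m. eapply deriv_eq.
      2:{ apply (derivable_pt_lim_mult (fun z => q * (p - 1) * z - p * (q - 1)) (fun z => Rpower z (- q))).
          - apply (derivable_pt_lim_minus (fun z => q * (p - 1) * z) (fun _ => p * (q - 1))).
            + apply (derivable_pt_lim_scal (fun z => z)). apply derivable_pt_lim_id.
            + apply derivable_pt_lim_const.
          - apply derivable_pt_lim_power; lra. }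
      rewrite (Rpower_pred z (- q)) by lra. ring.
    - intros z hz. assert (h1 := Rpower_pos z (- q - 1)).
      apply Rmult_lt_0_compat; [|nra].
      apply Rmult_lt_0_compat; [nra|auto]. }
  assert (hwq := Rpower_pos w q).
  assert (hinv : Rpower w (- q) * Rpower w q = 1).
  { rewrite <- Rpower_plus. replace (- q + q) with 0 by ring. apply Rpower_O; lra. }
  assert (h1 : (p - q) * Rpower w q <= q * (p - 1) * w - p * (q - 1)).
  { apply Rle_trans with (m w * Rpower w q); [apply Rmult_le_compat_r; lra|].
    unfold m. rewrite Rmult_assoc, hinv. lra. }
  assert (hxq := Rpower_gt_1 x q hx ltac:(lra)).
  unfold t_den. assert (0 < (p - q) * Rpower w q) by (apply Rmult_lt_0_compat; lra).
  nra.
Qed.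

(** The right side of the equation for [t] is positive, hence so is the factor
    [p - (p-1) w] of the left side. *)
Lemma width_bound (s : R) : admissible s -> s_crit <= s ->
  let w := width s (t p q s1 s) in 0 < p - (p - 1) * w.
Proof.
  intros hs hc w. destruct (t_spec s hs) as [h1 [h2 [h3 [h4 h5]]]].
  assert (hl := h4 hc). assert (hr := rhs_pos s (proj1 hs)).
  assert (hg := gap_pos s (t p q s1 s) hs ltac:(lra)).
  destruct (width_spec s (t p q s1 s) hs ltac:(lra)) as [hw _].
  unfold lhs in hl. cbv zeta in hl. fold w in hl, hw.
  rewrite (Rpower_pred w q) in hl by lra.
  assert (hu := Rpower_pos w (q - 1)). set (u := Rpower w (q - 1)) in *.
  set (g := gap s (t p q s1 s)) in *.
  apply (Rmult_lt_reg_l (q * u * g)).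
  - apply Rmult_lt_0_compat; [apply Rmult_lt_0_compat|]; lra.
  - rewrite Rmult_0_r.
    replace (q * u * g * (p - (p - 1) * w)) with (q * (p * u - (p - 1) * (w * u)) * g) by ring.
    lra.
Qed.

Lemma width_gap (s x : R) : admissible s -> 1 <= x -> tau p q s1 s x <= 1 ->
  p * (H q (width s x) * gap s x) = (p - q) * (Rpower x p - s1).
Proof.
  intros hs hx ht. destruct (width_spec s x hs hx) as [_ ->].
  rewrite Rmin_right by lra. now apply tau_gap.
Qed.

Lemma width_pow_gap (s x : R) : admissible s -> 1 <= x -> tau p q s1 s x <= 1 ->
  lhs s x = rhs s ->
  Rpower (width s x) q * gap s x + s1 * (1 + alpha q s) = Rpower x p.
Proof.
  intros hs hx ht he. assert (hl := lhs_rhs s x hs hx ht).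
  rewrite he in hl. apply (Rmult_eq_reg_l (p - q)); lra.
Qed.

Lemma ratio_deriv (s : R) : 0 < s ->
  derivable_pt_lim (fun o => s1 / o) s (- (s1 / s ^ 2)).
Proof.
  intros hs. eapply deriv_eq.
  2:{ apply (derivable_pt_lim_div (fun _ => s1) (fun o => o)).
      - apply derivable_pt_lim_const.
      - apply derivable_pt_lim_id.
      - lra. }
  unfold Rsqr. field. lra.
Qed.

(** [f1] and [f2] below are the increments of relations (1) and (2) of the
    introduction; [p * Hs] times the second minus [Q] times the first no longer
    contains the increment of [w].  This is uniform in [w >= 1], as the slope
    [Q] of [w^q] has a positive limit. *)
Lemma t_deriv_after (s : R) (S : R -> Prop) : admissible s -> s_crit <= s ->
  (forall o, S o -> admissible o /\ s_crit <= o /\ o <> s) ->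
  let x := t p q s1 s in
  limit1_in (fun o => (t p q s1 o - x) / (o - s)) S
    (t_deriv s x (width s x) (omega q s)) s.
Proof.
  intros hs hc hS x.
  destruct (t_spec s hs) as [hx [hx2 [hx3 [hx4 hx5]]]]. fold x in hx, hx2, hx3, hx4, hx5.
  assert (hxe := hx4 hc).
  assert (hs01 : 0 < s < 1) by apply hs.
  set (w := width s x). set (a := omega q s).
  assert (ha := omega_interior q s ltac:(lra) hs01). fold a in ha.
  destruct (width_spec s x hs ltac:(lra)) as [hw _]. fold w in hw.
  assert (hwp := width_bound s hs hc). cbv zeta in hwp. fold x in hwp. fold w in hwp.
  assert (hg := gap_pos s x hs ltac:(lra)).
  assert (htl : limit1_in (t p q s1) S x s).
  { apply limit1_imp with (D := admissible); [intros o ho; now apply hS|]. now apply t_cont. }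
  set (W := fun o => width o (t p q s1 o)).
  assert (hWl : limit1_in W S w s).
  { apply (width_lim (fun o => o) (t p q s1)); try lra; auto.
    - apply tau_pos; auto; lra.
    - apply lim_x. }
  destruct (lim_slope _ (t p q s1) _ S x s (derivable_pt_lim_power x (p - q) ltac:(lra)) htl)
    as [T1 [hT1 lT1]].
  destruct (lim_slope _ (t p q s1) _ S x s (derivable_pt_lim_power x p ltac:(lra)) htl)
    as [T2 [hT2 lT2]].
  destruct (lim_slope _ W _ S w s (derivable_pt_lim_power w q ltac:(lra)) hWl)
    as [Q [hQ lQ]].
  destruct (lim_slope _ W _ S w s (H_deriv q w ltac:(lra)) hWl) as [Hs [hHs lHs]].
  destruct (lim_slope _ (fun o => o) _ S s s (alpha_deriv s hs01) (lim_x _ _)) as [K [hK lK]].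
  destruct (lim_slope _ (fun o => o) _ S s s (ratio_deriv s ltac:(lra)) (lim_x _ _))
    as [C [hC lC]].
  cbv beta in *.
  assert (lWq : limit1_in (fun o => Rpower (W o) q) S (Rpower w q) s).
  { apply (lim_cont (fun z => Rpower z q)); [|exact hWl].
    apply derivable_continuous_pt. eexists. apply derivable_pt_lim_power; lra. }
  assert (lHq : limit1_in (fun o => H q (W o)) S (H q w) s).
  { apply (lim_cont (H q)); [|exact hWl]. apply H_cont; lra. }
  assert (hden := t_den_pos x w hx ltac:(lra) hwp).
  set (y := Rpower x (p - q - 1)). assert (hy : 0 < y) by apply Rpower_pos.
  assert (hxp : Rpower x (p - 1) = y * Rpower x q).
  { unfold y. rewrite <- Rpower_plus. f_equal; ring. }
  set (u := Rpower w (q - 2)). assert (hu : 0 < u) by apply Rpower_pos.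
  assert (hcoef :
    p * (q * (q - 1) * (Rpower w (q - 2) * (1 - w)))
      * (Rpower w q * ((p - q) * Rpower x (p - q - 1)) - p * Rpower x (p - 1))
    - q * Rpower w (q - 1)
      * (p * (H q w * ((p - q) * Rpower x (p - q - 1))) - (p - q) * (p * Rpower x (p - 1)))
    = p * q * u * y * t_den x w).
  { unfold t_den. rewrite H_factor by lra.
    rewrite (Rpower_pred w q), (Rpower_pred w (q - 1)) by lra.
    replace (q - 1 - 1) with (q - 2) by ring. fold u. rewrite hxp. fold y. ring. }
  eapply lim_eq.
  2:{ apply (lim_ratio
       (fun o => p * Hs o * (Rpower (W o) q * T1 o - T2 o)
                 - Q o * (p * (H q (W o) * T1 o) - (p - q) * T2 o))
       (fun o => p * Hs o * (s1 * K o - Rpower (W o) q * C o)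
                 + Q o * (p * (H q (W o) * C o)))
       (fun o => t p q s1 o - x) (fun o => o - s)).
      - intros o ho. destruct (hS o ho) as [ho1 [ho2 ho3]].
        destruct (t_spec o ho1) as [k1 [k2 [k3 [k4 k5]]]]. assert (k6 := k4 ho2).
        assert (e1 := width_gap s x hs ltac:(lra) hx2).
        assert (e3 := width_pow_gap s x hs ltac:(lra) hx2 hxe).
        assert (e1' := width_gap o (t p q s1 o) ho1 ltac:(lra) k2).
        assert (e2' := width_pow_gap o (t p q s1 o) ho1 ltac:(lra) k2 k6).
        fold w in e1, e3. fold (W o) in e1', e2'.
        assert (m1 := hT1 o). assert (m2 := hT2 o). assert (m3 := hQ o).
        assert (m4 := hHs o). assert (m5 := hK o). assert (m6 := hC o).
        assert (hgd : gap o (t p q s1 o) - gap s x = T1 o * (t p q s1 o - x) - C o * (o - s)).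
        { unfold gap. lra. }
        set (X := t p q s1 o) in *. set (E := gap s x) in *. set (E' := gap o X) in *.
        assert (f2 : Rpower (W o) q * (T1 o * (X - x) - C o * (o - s)) + E * (Q o * (W o - w))
                  + s1 * (K o * (o - s)) - T2 o * (X - x) = 0).
        { rewrite <- hgd, <- m2, <- m3, <- m5. lra. }
        assert (f1 : p * (H q (W o) * (T1 o * (X - x) - C o * (o - s)) + E * (Hs o * (W o - w)))
                  - (p - q) * (T2 o * (X - x)) = 0).
        { rewrite <- hgd, <- m2, <- m4. lra. }
        match type of f2 with ?l3 = 0 => match type of f1 with ?l1 = 0 =>
          transitivity (p * Hs o * l3 - Q o * l1); [ring|rewrite f2, f1; ring] end end.
      - intros o ho. destruct (hS o ho) as [_ [_ ho3]]. lra.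
      - apply limit_minus.
        + apply limit_mul; [apply limit_mul; [apply lim_const|exact lHs]|].
          apply limit_minus; [apply limit_mul; [exact lWq|exact lT1]|exact lT2].
        + apply limit_mul; [exact lQ|].
          apply limit_minus; (apply limit_mul; [apply lim_const|]); [|exact lT2].
          apply limit_mul; [exact lHq|exact lT1].
      - apply limit_plus.
        + apply limit_mul; [apply limit_mul; [apply lim_const|exact lHs]|].
          apply limit_minus; [apply limit_mul; [apply lim_const|exact lK]
                             |apply limit_mul; [exact lWq|exact lC]].
        + apply limit_mul; [exact lQ|]. apply limit_mul; [apply lim_const|].
          apply limit_mul; [exact lHq|exact lC].
      - rewrite hcoef. apply Rgt_not_eq. repeat apply Rmult_lt_0_compat; lra. }
  rewrite hcoef.
  match goal with |- - ?d / _ = _ =>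
    replace d with (- (p * q * u * (s1 / s ^ 2)
      * (w * (w * u) - (w - 1) * (Rpower a q / (a - 1))))) end.
  - unfold t_deriv. fold y. rewrite (Rpower_pred w q), (Rpower_pred w (q - 1)) by lra.
    replace (q - 1 - 1) with (q - 2) by ring. fold u. field. repeat split; lra.
  - fold a. rewrite H_factor by lra.
    rewrite (Rpower_pred w q), (Rpower_pred w (q - 1)) by lra.
    replace (q - 1 - 1) with (q - 2) by ring. fold u. field. lra.
Qed.

(** When [s_crit < s] the set stays away from [s].  When [s = s_crit], relation
    (1) with [w = 1] holds throughout, and its implicit derivative is the value
    of [t_deriv] at [w = 1]. *)
Lemma t_deriv_before (s : R) (S : R -> Prop) : admissible s -> s_crit <= s ->
  (forall o, S o -> admissible o /\ o < s_crit) ->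
  let x := t p q s1 s in
  limit1_in (fun o => (t p q s1 o - x) / (o - s)) S
    (t_deriv s x (width s x) (omega q s)) s.
Proof.
  intros hs hc hS x.
  destruct hc as [hc|hc].
  { apply (lim_ext_near (fun _ => t_deriv s x (width s x) (omega q s)) _ _ _ _ (s - s_crit));
      [lra| |apply lim_const].
    intros o ho1 ho2. destruct (hS o ho1) as [_ ho3]. apply Rabs_def2 in ho2. lra. }
  destruct (t_spec s hs) as [hx [hx2 [hx3 [hx4 hx5]]]]. fold x in hx, hx2, hx3, hx4, hx5.
  assert (hxt := hx5 ltac:(lra)).
  assert (hs01 : 0 < s < 1) by apply hs.
  assert (ha := omega_interior q s ltac:(lra) hs01).
  assert (htl : limit1_in (t p q s1) S x s).
  { apply limit1_imp with (D := admissible); [intros o ho; now apply hS|]. now apply t_cont. }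
  destruct (lim_slope _ (t p q s1) _ S x s (derivable_pt_lim_power x (p - q) ltac:(lra)) htl)
    as [T1 [hT1 lT1]].
  destruct (lim_slope _ (t p q s1) _ S x s (derivable_pt_lim_power x p ltac:(lra)) htl)
    as [T2 [hT2 lT2]].
  destruct (lim_slope _ (fun o => o) _ S s s (ratio_deriv s ltac:(lra)) (lim_x _ _))
    as [C [hC lC]].
  cbv beta in *.
  set (y := Rpower x (p - q - 1)). assert (hy : 0 < y) by apply Rpower_pos.
  assert (hxp : Rpower x (p - 1) = y * Rpower x q).
  { unfold y. rewrite <- Rpower_plus. f_equal; ring. }
  assert (hxq := Rpower_gt_1 x q hx ltac:(lra)).
  assert (hz : 0 < y * (Rpower x q - 1)) by (apply Rmult_lt_0_compat; lra).
  eapply lim_eq.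
  2:{ apply (lim_ratio (fun o => (p - q) * T2 o - p * T1 o) (fun o => p * C o)
       (fun o => t p q s1 o - x) (fun o => o - s)).
      - intros o ho. destruct (hS o ho) as [ho1 ho2].
        destruct (t_spec o ho1) as [k1 [k2 [k3 [k4 k5]]]].
        assert (e1 := tau_gap s x hs ltac:(lra)).
        assert (e1' := tau_gap o (t p q s1 o) ho1 ltac:(lra)).
        rewrite hxt in e1. rewrite (k5 ltac:(lra)) in e1'. unfold gap in e1, e1'.
        assert (m1 := hT1 o). assert (m2 := hT2 o). assert (m3 := hC o).
        match goal with |- ?l = 0 =>
          transitivity ((p - q) * (T2 o * (t p q s1 o - x))
            - p * (T1 o * (t p q s1 o - x) - C o * (o - s))); [ring|] end.
        rewrite <- m1, <- m2, <- m3. lra.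
      - intros o ho. destruct (hS o ho) as [_ ho3]. lra.
      - apply limit_minus; (apply limit_mul; [apply lim_const|eassumption]).
      - apply limit_mul; [apply lim_const|eassumption].
      - rewrite hxp. fold y.
        replace ((p - q) * (p * (y * Rpower x q)) - p * ((p - q) * y))
          with ((p - q) * p * (y * (Rpower x q - 1))) by ring.
        apply Rgt_not_eq. repeat apply Rmult_lt_0_compat; lra. }
  rewrite (width_at_1 s x hxt). unfold t_deriv, t_den.
  rewrite Rpower_one_l, hxp. fold y. 
  assert (hz' : 0 < (p - q) * (Rpower x q - 1)) by (apply Rmult_lt_0_compat; lra).
  assert (hz'' : 0 < (p - q) * p * (y * (Rpower x q - 1)))
    by (repeat apply Rmult_lt_0_compat; lra).
  field. repeat split; lra.
Qed.

Lemma t_is_deriv (s : R) : (forall o, Defs.D p q s1 o -> admissible o) ->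
  admissible s -> s_crit <= s ->
  is_dt_ds2 p q s1 s
    (t_deriv s (t p q s1 s) (width s (t p q s1 s)) (omega q s)).
Proof.
  intros hD hs hc. unfold is_dt_ds2, D_in.
  apply (lim_union _ (fun o => admissible o /\ s_crit <= o /\ o <> s)
                     (fun o => admissible o /\ o < s_crit)).
  - intros o [ho1 ho2]. assert (ho := hD o ho1).
    destruct (Rle_or_lt s_crit o); [left|right]; auto.
  - now apply t_deriv_after.
  - now apply t_deriv_before.
Qed.

(** * The sign of the derivative *)

Lemma pow_quot_decr (x y : R) : 1 <= x -> x < y -> y <= q / (q - 1) ->
  (x - 1) * Rpower y q < Rpower x q * (y - 1).
Proof.
  intros hx hxy hy.
  set (m := fun z => (z - 1) * Rpower z (- q)).
  assert (hm : m x < m y).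
  { apply (increasing_of_deriv m (fun z => Rpower z (- q - 1) * (q - (q - 1) * z))); auto.
    - intros z hz. unfold m. eapply deriv_eq.
      2:{ apply (derivable_pt_lim_mult (fun z => z - 1) (fun z => Rpower z (- q))).
          - apply (derivable_pt_lim_minus (fun z => z) (fun _ => 1)).
            + apply derivable_pt_lim_id.
            + apply derivable_pt_lim_const.
          - apply derivable_pt_lim_power; lra. }
      rewrite (Rpower_pred z (- q)) by lra. ring.
    - intros z hz. apply Rmult_lt_0_compat; [apply Rpower_pos|].
      assert (z < q / (q - 1)) by lra.
      assert (z * (q - 1) < q) by (apply Rlt_div_r; lra). lra. }
  assert (hinv : forall z, 0 < z -> Rpower z (- q) = / Rpower z q) by (intros; apply Rpower_Ropp).
  unfold m in hm. rewrite !hinv in hm by lra.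
  assert (h1 := Rpower_pos x q). assert (h2 := Rpower_pos y q).
  apply (Rmult_lt_compat_r (Rpower x q * Rpower y q)) in hm; [|now apply Rmult_lt_0_compat].
  field_simplify in hm; lra.
Qed.

Let b := omega p s1.

Lemma b_spec : 1 < b < q / (q - 1) /\ H p b = s1 /\ 0 < p - (p - 1) * b.
Proof.
  assert (hb := omega_interior p s1 ltac:(lra) hs1). fold b in hb.
  assert (hH : H p b = s1) by (apply omega_spec; lra).
  assert (h1 : b * (p - 1) < p) by (apply Rlt_div_r; lra).
  split; [|split; [exact hH|lra]]. split; [lra|]. apply Rlt_div_r; [lra|]. nra.
Qed.

Lemma s2_prime_range : 0 < s2_prime p q s1 < 1.
Proof.
  destruct b_spec as [hb _]. unfold s2_prime. fold b. split.
  - rewrite <- (H_at_conj q) by lra. apply H_decr; lra.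
  - rewrite <- (H_at_1 q). apply H_decr; lra.
Qed.

Lemma omega_s2_prime : omega q (s2_prime p q s1) = b.
Proof. destruct b_spec as [hb _]. apply omega_H; lra. Qed.

(** This identity is where the exponent [p] and [omega p s1] enter: it turns the
    comparison of [tau] at [x = a] with [s = H q a] into that of [s1] with
    [H p a]. *)
Lemma tau_at_omega (s : R) : admissible s ->
  p * (gap s (omega q s) * (s - tau p q s1 s (omega q s))) = q * (H p (omega q s) - s1).
Proof.
  intros hs. assert (hs01 := proj1 hs).
  assert (ha := omega_interior q s ltac:(lra) hs01).
  destruct (omega_spec q s) as [_ hH]; [lra|lra|].
  assert (hg := tau_gap s (omega q s) hs ltac:(lra)).
  set (a := omega q s) in *.
  transitivity (p * (gap s a * s) - p * (tau p q s1 s a * gap s a)); [ring|].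
  rewrite hg. unfold gap.
  replace ((Rpower a (p - q) - s1 / s) * s) with (Rpower a (p - q) * s - s1) by (field; lra).
  rewrite <- hH at 1. unfold H.
  assert (e1 : Rpower a p = Rpower a (p - q) * Rpower a q).
  { rewrite <- Rpower_plus. f_equal; ring. }
  assert (e2 : Rpower a (p - 1) = Rpower a (p - q) * Rpower a (q - 1)).
  { rewrite <- Rpower_plus. f_equal; ring. }
  rewrite e1, e2. ring.
Qed.

(** Relation (2) makes [t^q] a mean of [w^q] and [a^q], with weights
    [gap / t^(p-q)] and [(s1 / s) / t^(p-q)]. *)
Lemma t_le_of_width (s : R) : admissible s -> s_crit <= s ->
  let x := t p q s1 s in let w := width s x in let a := omega q s in
  (a <= w -> a <= x) /\ (w <= a -> x <= a).
Proof.
  intros hs hc x w a.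
  destruct (t_spec s hs) as [hx [hx2 [hx3 [hx4 hx5]]]]. fold x in hx, hx2, hx3, hx4, hx5.
  assert (hs01 := proj1 hs).
  assert (ha := omega_interior q s ltac:(lra) hs01). fold a in ha.
  destruct (width_spec s x hs ltac:(lra)) as [hw _]. fold w in hw.
  assert (e3 := width_pow_gap s x hs ltac:(lra) hx2 (hx4 hc)). fold w in e3.
  assert (hg := gap_pos s x hs ltac:(lra)).
  assert (hcr := ratio_lt_1 s hs).
  assert (hk : s1 * (1 + alpha q s) = s1 / s * Rpower a q).
  { unfold alpha. fold a. field. lra. }
  rewrite hk in e3.
  assert (hsplit : Rpower x p = Rpower x (p - q) * Rpower x q).
  { rewrite <- Rpower_plus. f_equal; ring. }
  rewrite hsplit in e3.
  assert (hxr : Rpower x (p - q) = gap s x + s1 / s) by (unfold gap; ring).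
  rewrite hxr in e3.
  split; intros hwa.
  - destruct (Rle_or_lt a x) as [|hl]; auto.
    assert (h1 := Rlt_Rpower_l x a q ltac:(lra) ltac:(lra)).
    assert (h2 := Rle_Rpower_l a w q ltac:(lra) ltac:(lra)).
    assert (gap s x * Rpower x q < gap s x * Rpower w q) by (apply Rmult_lt_compat_l; lra).
    assert (s1 / s * Rpower x q < s1 / s * Rpower a q) by (apply Rmult_lt_compat_l; lra).
    lra.
  - destruct (Rle_or_lt x a) as [|hl]; auto.
    assert (h1 := Rlt_Rpower_l a x q ltac:(lra) ltac:(lra)).
    assert (h2 := Rle_Rpower_l w a q ltac:(lra) ltac:(lra)).
    assert (gap s x * Rpower w q < gap s x * Rpower x q) by (apply Rmult_lt_compat_l; lra).
    assert (s1 / s * Rpower a q < s1 / s * Rpower x q) by (apply Rmult_lt_compat_l; lra).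
    lra.
Qed.

Lemma width_vs_omega (s : R) : admissible s -> s_crit <= s ->
  let w := width s (t p q s1 s) in let a := omega q s in
  (s < s2_prime p q s1 -> w < a) /\ (s2_prime p q s1 < s -> a < w).
Proof.
  intros hs hc. cbv zeta.
  destruct (t_le_of_width s hs hc) as [le1 le2].
  destruct (t_spec s hs) as [hx [hx2 [hx3 [hx4 hx5]]]].
  set (x := t p q s1 s) in *. set (w := width s x) in *.
  assert (hs01 := proj1 hs). assert (hp01 := s2_prime_range).
  destruct b_spec as [hb [hHb _]].
  assert (ha := omega_interior q s ltac:(lra) hs01).
  destruct (omega_spec q s ltac:(lra) ltac:(lra)) as [_ hHa].
  destruct (width_spec s x hs ltac:(lra)) as [hw hHw]. fold w in hw, hHw.
  rewrite Rmin_right in hHw by lra.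
  assert (hta := tau_at_omega s hs).
  set (a := omega q s) in *.
  assert (hg := gap_pos s a hs ltac:(lra)).
  split; intros hlt.
  - assert (hba : b < a).
    { rewrite <- omega_s2_prime. apply omega_decr; lra. }
    assert (hHpa := H_decr p b a ltac:(lra) ltac:(lra) hba).
    assert (hst : s < tau p q s1 s a).
    { assert (hm : gap s a * (s - tau p q s1 s a) < 0) by nra. nra. }
    destruct (Rlt_or_le w a) as [|hwa]; auto.
    assert (hax := le1 hwa).
    assert (tau p q s1 s a <= tau p q s1 s x).
    { destruct hax as [hax|hax]; [left; apply tau_incr; auto; lra|rewrite hax; lra]. }
    destruct hwa as [hwa|hwa]; [|rewrite <- hwa in hHw; lra].
    assert (hd := H_decr q a w). lra.
  - assert (hba : a < b).
    { rewrite <- omega_s2_prime. apply omega_decr; lra. }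
    assert (hHpa := H_decr p a b ltac:(lra) ltac:(lra) hba).
    assert (hst : tau p q s1 s a < s).
    { assert (hm : 0 < gap s a * (s - tau p q s1 s a)) by nra. nra. }
    destruct (Rlt_or_le a w) as [|hwa]; auto.
    assert (hax := le2 hwa).
    assert (tau p q s1 s x <= tau p q s1 s a).
    { destruct hax as [hax|hax]; [left; apply tau_incr; auto; lra|rewrite hax; lra]. }
    destruct hwa as [hwa|hwa]; [|rewrite hwa in hHw; lra].
    assert (hd := H_decr q w a). lra.
Qed.

Lemma t_deriv_sign (s : R) : admissible s -> s_crit <= s ->
  let l := t_deriv s (t p q s1 s) (width s (t p q s1 s)) (omega q s) in
  (s < s2_prime p q s1 -> 0 < l) /\ (s2_prime p q s1 < s -> l < 0).
Proof.
  intros hs hc. cbv zeta. destruct (width_vs_omega s hs hc) as [v1 v2].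
  destruct (t_spec s hs) as [hx [hx2 [hx3 [hx4 hx5]]]].
  assert (hwp := width_bound s hs hc). cbv zeta in hwp.
  set (x := t p q s1 s) in *.
  destruct (width_spec s x hs ltac:(lra)) as [hw _].
  assert (hs01 := proj1 hs).
  assert (ha := omega_interior q s ltac:(lra) hs01).
  set (w := width s x) in *. set (a := omega q s) in *.
  assert (hden := t_den_pos x w hx ltac:(lra) hwp).
  assert (hy := Rpower_pos x (p - q - 1)).
  assert (hl : t_deriv s x w a
    = s1 / s ^ 2 / (Rpower x (p - q - 1) * t_den x w) / (a - 1)
      * (Rpower w q * (a - 1) - (w - 1) * Rpower a q)).
  { unfold t_deriv. field. repeat split; lra. }
  assert (hk : 0 < s1 / s ^ 2 / (Rpower x (p - q - 1) * t_den x w) / (a - 1)).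
  { repeat apply Rdiv_lt_0_compat; try lra.
    - apply pow_lt; lra.
    - now apply Rmult_lt_0_compat. }
  rewrite hl. split; intros hlt.
  - assert (hm := pow_quot_decr w a ltac:(lra) (v1 hlt) ltac:(lra)). nra.
  - assert (hm := pow_quot_decr a w ltac:(lra) (v2 hlt) ltac:(lra)). nra.
Qed.

(** * The domain and the turning point *)

Lemma D_root (s : R) : Defs.D p q s1 s <-> Rpower s1 ((q - 1) / (p - 1)) <= s < 1.
Proof.
  assert (hth : 0 < (q - 1) / (p - 1)) by (apply Rdiv_lt_0_compat; lra).
  assert (hr := Rpower_pos s1 ((q - 1) / (p - 1))).
  assert (he : Rpower (Rpower s1 ((q - 1) / (p - 1))) (p - 1) = Rpower s1 (q - 1)).
  { rewrite Rpower_mult. f_equal. field. lra. }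
  unfold Defs.D. rewrite <- he. set (r := Rpower s1 ((q - 1) / (p - 1))) in *. split.
  - intros [_ [hs [h1 h2]]]. split.
    + destruct (Rle_or_lt r s) as [|hl]; auto.
      assert (hi := Rlt_Rpower_l s r (p - 1)). lra.
    + destruct (Rlt_or_le s 1) as [|hl]; auto.
      assert (hi := Rpower_ge_1 s (p - 1)). lra.
  - intros [h1 h2]. split; [lra|]. split; [lra|]. split.
    + apply Rle_Rpower_l; lra.
    + apply Rpower_lt_1; lra.
Qed.

(** With [e = (q-1) / (p-1)], membership gives [s1 / s <= s1^(1-e)], which
    [Rpower_bernoulli] bounds by [1 + (1-e)(s1 - 1)]; and [p e < q]. *)
Lemma D_admissible (s : R) : Defs.D p q s1 s -> admissible s.
Proof.
  rewrite D_root. set (e := (q - 1) / (p - 1)). intros [h1 h2].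
  assert (hth : 0 < e < 1).
  { unfold e; split; [apply Rdiv_lt_0_compat|apply Rlt_div_l]; lra. }
  assert (hr := Rpower_pos s1 e).
  split; [lra|].
  assert (hb := Rpower_bernoulli s1 (1 - e) ltac:(lra) ltac:(lra)).
  assert (hc : s1 / s <= Rpower s1 (1 - e)).
  { apply Rle_div_l; [lra|].
    apply Rle_trans with (Rpower s1 (1 - e) * Rpower s1 e).
    - rewrite <- Rpower_plus. replace (1 - e + e) with 1 by ring. rewrite Rpower_1; lra.
    - apply Rmult_le_compat_l; [|lra]. apply Rlt_le, Rpower_pos. }
  assert (he : p * e < q).
  { unfold e. replace (p * ((q - 1) / (p - 1))) with (p * (q - 1) / (p - 1)) by (field; lra).
    apply Rlt_div_l; nra. }
  assert (p * (s1 / s) <= p * (1 + (1 - e) * (s1 - 1))) by (apply Rmult_le_compat_l; lra).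
  nra.
Qed.

(** With [y = p - (p-1) b] this is [y^e <= 1 + e (y - 1)] multiplied by
    [b^(q-1)]. *)
Lemma s2_prime_D : Defs.D p q s1 (s2_prime p q s1).
Proof.
  apply D_root. split; [|apply s2_prime_range].
  destruct b_spec as [hb [hHb hbp]]. set (e := (q - 1) / (p - 1)).
  assert (hth : 0 < e < 1).
  { unfold e; split; [apply Rdiv_lt_0_compat|apply Rlt_div_l]; lra. }
  assert (hbn := Rpower_bernoulli (p - (p - 1) * b) e hbp hth).
  assert (he : 1 + e * (p - (p - 1) * b - 1) = q - (q - 1) * b) by (unfold e; field; lra).
  rewrite he in hbn.
  rewrite <- hHb at 1. unfold s2_prime. fold b.
  rewrite !H_factor by lra. rewrite <- Rpower_mult_distr by (auto; apply Rpower_pos).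
  rewrite Rpower_mult. replace ((p - 1) * e) with (q - 1) by (unfold e; field; lra).
  apply Rmult_le_compat_l; [apply Rlt_le, Rpower_pos|exact hbn].
Qed.

(** At the turning point [x = b] solves the equation of the first branch, with
    [tau < 1]; by monotonicity the left side exceeds the right one at [t0]. *)
Lemma s_crit_le_s2_prime : s_crit <= s2_prime p q s1.
Proof.
  assert (hs := D_admissible _ s2_prime_D). assert (hr := s2_prime_range).
  destruct b_spec as [hb [hHb _]].
  assert (hta := tau_at_omega _ hs). rewrite omega_s2_prime, hHb in hta.
  assert (ho := omega_s2_prime).
  set (s := s2_prime p q s1) in *.
  destruct (Rle_or_lt s_crit s) as [|hlt]; auto.
  destruct (t0_spec s hs) as [h0 h1]. destruct (lhs_at_t0 s hs) as [hl _].
  assert (hl' := hl hlt). assert (hrp := rhs_pos s hr).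
  assert (hg := gap_pos s b hs ltac:(lra)).
  assert (htb : tau p q s1 s b = s).
  { assert (hz : gap s b * (s - tau p q s1 s b) = 0) by nra.
    apply Rmult_integral in hz. lra. }
  assert (hwb : width s b = b).
  { unfold width. rewrite htb, Rmin_right by lra. exact ho. }
  assert (hlb := lhs_rhs s b hs ltac:(lra) ltac:(lra)).
  rewrite hwb in hlb. unfold alpha in hlb. rewrite ho in hlb. unfold gap in hlb.
  assert (hsplit : Rpower b p = Rpower b (p - q) * Rpower b q).
  { rewrite <- Rpower_plus. f_equal; ring. }
  rewrite hsplit in hlb.
  assert (hz : lhs s b - rhs s = 0) by (rewrite hlb; field; lra).
  assert (hbt : b < t0 p q s1 s).
  { destruct (Rlt_or_le b (t0 p q s1 s)) as [|[hh|hh]]; auto.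
    - assert (hi := tau_incr s (t0 p q s1 s) b hs). lra.
    - rewrite hh in h1. lra. }
  assert (hi := lhs_incr s b (t0 p q s1 s) hs). lra.
Qed.

End Slice.

Theorem mainTheorem1 :
  forall p q s1 : R, 1 < q < p -> 0 < s1 < 1 ->
    (forall s2 : R, s2_second p q s1 <= s2 < s2_prime p q s1 ->
       exists l : R, is_dt_ds2 p q s1 s2 l /\ 0 < l) /\
    (forall s2 : R, s2_prime p q s1 < s2 < 1 ->
       exists l : R, is_dt_ds2 p q s1 s2 l /\ l < 0).
Proof.
  intros p q s1 hpq hs1.
  assert (hD := D_admissible p q s1 hpq hs1).
  assert (hr := s2_prime_range p q s1 hpq hs1).
  assert (hp := s2_prime_D p q s1 hpq hs1).
  apply D_root in hp; auto.
  assert (hc := s_crit_le_s2_prime p q s1 hpq hs1). unfold s_crit in hc.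
  assert (hmain : forall s, Rpower s1 ((q - 1) / (p - 1)) <= s < 1 ->
    h_inv p q (1 / Rpower s1 q) <= s ->
    exists l, is_dt_ds2 p q s1 s l /\ (s < s2_prime p q s1 -> 0 < l)
      /\ (s2_prime p q s1 < s -> l < 0)).
  { intros s hs hcs. apply D_root in hs; auto. apply hD in hs.
    eexists. split; [now apply t_is_deriv|]. now apply t_deriv_sign. }
  split; intros s [h1 h2].
  - unfold s2_second in h1.
    assert (m1 := Rmax_l (Rpower s1 ((q - 1) / (p - 1))) (h_inv p q (1 / Rpower s1 q))).
    assert (m2 := Rmax_r (Rpower s1 ((q - 1) / (p - 1))) (h_inv p q (1 / Rpower s1 q))).
    destruct (hmain s) as [l [hl1 [hl2 hl3]]]; try lra. exists l; auto.
  - destruct (hmain s) as [l [hl1 [hl2 hl3]]]; try lra. exists l; auto.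
Qed.
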